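(* Let $T$ be a bounded linear operator on an arbitrary (not necessarily separable) complex Hilbert space $\mathcal{H}$, and let $k,n$ be positive integers. If $T$ is $k$-quasiparanormal and $T^n$ is normal, then there is an orthogonal decomposition $\mathcal{H}=\mathcal{H}_1\oplus\mathcal{H}_2$ into subspaces reducing $T$ such that $T=N\oplus L$, where $N=T|_{\mathcal{H}_1}$ is normal and $L=T|_{\mathcal{H}_2}$ is nilpotent of index at most $\min\{n,k+1\}$, i.e. $L^{\min\{n,k+1\}}=O$ (either summand may be absent).
   Context: For a positive integer $k$, $T$ is $k$-quasiparanormal if $\|T(T^kx)\|^2\le\|T^2(T^kx)\|\,\|T^kx\|$ for every $x\in\mathcal{H}$. A subspace reduces $T$ if it is invariant under $T$ and $T^*$. *)

(* Defs.v *)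
From HB Require Import structures.
From mathcomp Require Import all_boot all_order all_algebra.
From mathcomp Require Import reals.
From mathcomp Require Import complex.
Set Implicit Arguments. Unset Strict Implicit. Unset Printing Implicit Defensive.
Import Order.TTheory GRing.Theory Num.Theory.
Local Open Scope ring_scope.

Definition inner_product (R : realType) (V : lmodType R[i]) (ip : V -> V -> R[i]) :=
  [/\ forall a x y z, ip (a *: x + y) z = a * ip x z + ip y z,
      forall x y, ip y x = Num.conj (ip x y),
      forall x, 0 <= ip x x
    & forall x, ip x x = 0 -> x = 0].

Definition hnorm (R : realType) (V : lmodType R[i]) (ip : V -> V -> R[i]) (x : V) : R :=
  Num.sqrt (complex.Re (ip x x)).

Definition hcauchy (R : realType) (V : lmodType R[i]) (ip : V -> V -> R[i])
  (u : nat -> V) :=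
  forall e : R, 0 < e -> exists N : nat, forall m p, (N <= m)%N -> (N <= p)%N ->
    hnorm ip (u m - u p) < e.

Definition hconverges (R : realType) (V : lmodType R[i]) (ip : V -> V -> R[i])
  (u : nat -> V) (l : V) :=
  forall e : R, 0 < e -> exists N : nat, forall m, (N <= m)%N -> hnorm ip (u m - l) < e.

Definition hilbert_space (R : realType) (V : lmodType R[i]) (ip : V -> V -> R[i]) :=
  inner_product ip /\
  forall u : nat -> V, hcauchy ip u -> exists l, hconverges ip u l.

Definition bounded_linear (R : realType) (V : lmodType R[i]) (ip : V -> V -> R[i])
  (T : V -> V) :=
  (forall (a : R[i]) x y, T (a *: x + y) = a *: T x + T y) /\
  exists M : R, forall x, hnorm ip (T x) <= M * hnorm ip x.

Definition is_adjoint (R : realType) (V : lmodType R[i]) (ip : V -> V -> R[i])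
  (T Ts : V -> V) := forall x y, ip (T x) y = ip x (Ts y).

Definition opow (V : Type) (T : V -> V) (m : nat) : V -> V := iter m T.

Definition k_quasiparanormal (R : realType) (V : lmodType R[i]) (ip : V -> V -> R[i])
  (k : nat) (T : V -> V) :=
  forall x, hnorm ip (T (opow T k x)) ^+ 2
            <= hnorm ip (opow T 2 (opow T k x)) * hnorm ip (opow T k x).

Definition closed_subspace (R : realType) (V : lmodType R[i]) (ip : V -> V -> R[i])
  (H : V -> Prop) :=
  [/\ H 0,
      forall (a : R[i]) x y, H x -> H y -> H (a *: x + y)
    & forall (u : nat -> V) l, (forall m, H (u m)) -> hconverges ip u l -> H l].

Definition reduces (V : Type) (H : V -> Prop) (T Ts : V -> V) :=
  (forall x, H x -> H (T x)) /\ (forall x, H x -> H (Ts x)).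

(* Main.v *)
(* Let M = T^n, P = M^* M and Q = T^* T.  By Fuglede's theorem T commutes with
   M^*, hence with P, and so does Q.  Fix a spectral value p = l^n of P.  On the
   corresponding spectral part, k-quasiparanormality says that
   a_j = l^(-j) |T^j x|^2 is a convex sequence for j >= k, and T^* ^n T^n = P says
   that it is n-periodic; so it is constant, that is Q = l there.  No spectral
   theorem is used: localization at p is done with the Bernstein weights
   'C(N,m) P^m (1-P)^(N-m), which make P Q P^k a limit of operators A P^k with A a
   polynomial in P.  Therefore T commutes with Q P^(k+1).  This yields
   P^(k+1) M^* (T T^* - T^* T) = 0, so the self-commutator of T maps into ker M.
   Since ker M reduces T, T is normal on its orthogonal complement, and on ker M
   quasiparanormality forces the nilpotent operator T to satisfy T^(k+1) = 0.

   Fuglede's theorem is Rosenblum's Liouville argument with exp(u) replaced by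
   (1 + u/N)^N: the resulting function of z is a polynomial bounded on every
   circle, so its coefficient M^* T - T M^* vanishes. *)
Require Import Defs.
From HB Require Import structures.
From mathcomp Require Import all_boot all_order all_algebra.
From mathcomp Require Import boolp reals.
From mathcomp Require Import complex.
From mathcomp Require Import ring lra.
Import Order.TTheory GRing.Theory Num.Theory.
Local Open Scope ring_scope.
Local Open Scope complex_scope.
Local Notation Re := complex.Re.

(** * Inner product spaces and their adjointable operators *)

Section InnerProduct.
Set Implicit Arguments.
Unset Strict Implicit.
Variables (R : realType) (V : lmodType R[i]) (ip : V -> V -> R[i]).
Hypothesis hip : inner_product ip.
Implicit Types (x y z : V) (a : R[i]).

Lemma ipDl x y z : ip (x + y) z = ip x z + ip y z.
Proof. by case: hip => + _ _ _ => /(_ 1 x y z); rewrite scale1r mul1r. Qed.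

Lemma ip0l z : ip 0 z = 0.
Proof. by apply: (addrI (ip 0 z)); rewrite -ipDl !addr0. Qed.

Lemma ipZl a x z : ip (a *: x) z = a * ip x z.
Proof. by case: hip => + _ _ _ => /(_ a x 0 z); rewrite ip0l !addr0. Qed.

Lemma ipC x y : ip x y = conjc (ip y x).
Proof. by case: hip => _ h _ _; rewrite h. Qed.

Lemma ipDr x y z : ip z (x + y) = ip z x + ip z y.
Proof. by rewrite ipC ipDl rmorphD /= -!ipC. Qed.

Lemma ipZr a x z : ip z (a *: x) = conjc a * ip z x.
Proof. by rewrite ipC ipZl rmorphM /= -ipC. Qed.

Lemma ipNl x z : ip (- x) z = - ip x z.
Proof. by rewrite -scaleN1r ipZl mulN1r. Qed.

Lemma ipNr x z : ip z (- x) = - ip z x.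
Proof. by rewrite ipC ipNl rmorphN /= -ipC. Qed.

Lemma ip0r z : ip z 0 = 0.
Proof. by rewrite ipC ip0l rmorph0. Qed.

Lemma ip_inj x y : (forall z, ip z x = ip z y) -> x = y.
Proof.
case: hip => _ _ _ h0 h; apply/eqP; rewrite -subr_eq0; apply/eqP/h0.
by rewrite ipDr ipNr h subrr.
Qed.

Lemma Re_add (u v : R[i]) : Re (u + v) = Re u + Re v.
Proof. by case: u v => [? ?] [? ?]. Qed.

Lemma Re_opp (u : R[i]) : Re (- u) = - Re u.
Proof. by case: u. Qed.

Lemma Re_scale (a : R) (u : R[i]) : Re (a%:C * u) = a * Re u.
Proof. by case: u => ? ? /=; rewrite mul0r subr0. Qed.

Lemma Re_conj (u : R[i]) : Re (conjc u) = Re u.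
Proof. by case: u. Qed.

Lemma Re_ipC x y : Re (ip x y) = Re (ip y x).
Proof. by rewrite ipC Re_conj. Qed.

Lemma ipxx_ge0 x : 0 <= ip x x.
Proof. by case: hip. Qed.

Lemma hnorm_ge0 x : 0 <= hnorm ip x.
Proof. exact: sqrtr_ge0. Qed.

Lemma ipxxE x : ip x x = (hnorm ip x ^+ 2)%:C.
Proof.
have := ipxx_ge0 x; rewrite lecE /= => /andP[/eqP im0 re0].
by rewrite /hnorm sqr_sqrtr //; move: im0; case: (ip x x) => u v /= ->.
Qed.

Lemma hnorm2E x : hnorm ip x ^+ 2 = Re (ip x x).
Proof. by rewrite ipxxE. Qed.

Lemma hnorm0 : hnorm ip 0 = 0.
Proof. by rewrite /hnorm ip0l sqrtr0. Qed.

Lemma hnorm_eq0 x : hnorm ip x = 0 -> x = 0.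
Proof. by move=> h; case: hip => _ _ _; apply; rewrite ipxxE h expr0n. Qed.

Lemma hnormN x : hnorm ip (- x) = hnorm ip x.
Proof. by rewrite /hnorm ipNl ipNr opprK. Qed.

Lemma hnormB x y : hnorm ip (x - y) = hnorm ip (y - x).
Proof. by rewrite -hnormN opprB. Qed.

Lemma cauchy_schwarz x y : `|ip x y| <= (hnorm ip x * hnorm ip y)%:C.
Proof.
have [->|y0] := eqVneq y 0.
  by rewrite ip0r normr0 hnorm0 mulr0.
have ny : 0 < hnorm ip y.
  rewrite lt_neqAle hnorm_ge0 andbT eq_sym.
  by apply: contra_neq y0 => /hnorm_eq0.
have := ipxx_ge0 ((hnorm ip y ^+ 2)%:C *: x - ip x y *: y).
rewrite ipDl !ipDr !ipNl !ipNr !ipZl !ipZr !ipxxE (ipC y x) conjc_real.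
set b := (hnorm ip y ^+ 2)%:C; set a := (hnorm ip x ^+ 2)%:C; set c := ip x y.
have -> : b * (b * a) - b * (conjc c * c) +
    (- (c * (b * conjc c)) - - (c * (conjc c * b))) =
  b * (a * b - c * conjc c) by ring.
rewrite pmulr_rge0; last by rewrite /b ltcR exprn_gt0.
rewrite subr_ge0 -sqr_normc => h.
rewrite -(@ler_pXn2r _ 2) ?nnegrE ?normr_ge0 //; last first.
  by rewrite ler0c mulr_ge0 ?hnorm_ge0.
by rewrite (le_trans h) // /a /b -rmorphM -rmorphXn lecR exprMn.
Qed.

Lemma Re_cauchy_schwarz x y : `|Re (ip x y)| <= hnorm ip x * hnorm ip y.
Proof. by rewrite -lecR (le_trans (normc_ge_Re _)) ?cauchy_schwarz. Qed.

Lemma hnormD x y : hnorm ip (x + y) <= hnorm ip x + hnorm ip y.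
Proof.
rewrite -(@ler_pXn2r _ 2) ?nnegrE ?addr_ge0 ?hnorm_ge0 //.
rewrite hnorm2E ipDl !ipDr !Re_add -!hnorm2E (Re_ipC y x).
have := Re_cauchy_schwarz x y; rewrite ler_norml => /andP[_ h].
by nra.
Qed.

Lemma hnormZ a x : (hnorm ip (a *: x))%:C = `|a| * (hnorm ip x)%:C.
Proof.
apply/eqP; rewrite -(@eqrXn2 _ 2) ?mulr_ge0 ?ler0c ?hnorm_ge0 //; last first.
  by case: (a) => u v; exact: sqrtr_ge0.
by rewrite exprMn sqr_normc -!rmorphXn /= -!ipxxE ipZl ipZr mulrA.
Qed.

End InnerProduct.

(** * The ring with involution of adjointable operators *)

Section AdjointableOperators.
Set Implicit Arguments.
Unset Strict Implicit.
Variables (R : realType) (V : lmodType R[i]) (ip : V -> V -> R[i]).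

#[local] Obligation Tactic := idtac.

(** The adjoint is carried as a field, so that [op_star] merely swaps two fields; norm bounds are
    supplied separately by [opbound]. *)
Record adjop (hip : inner_product ip) := AdjOp {
  op_fun :> V -> V;
  op_adj : V -> V;
  op_lin : forall a x y, op_fun (a *: x + y) = a *: op_fun x + op_fun y;
  op_adjP : is_adjoint ip op_fun op_adj }.

Variable hip : inner_product ip.
Local Notation Op := (adjop hip).
Implicit Types A B : Op.

(** The inner product separates points, so the function determines its adjoint; the proof fields
    agree by proof irrelevance. *)
Lemma op_ext A B : (forall x, A x = B x) -> A = B.
Proof.
case: A B => [f g fl fg] [f' g' fl' fg'] /= /funext ff; subst f'.
have gg : g = g'.
  by apply/funext => y; apply: (ip_inj hip) => z; rewrite -fg -fg'.
by subst g'; congr AdjOp; exact: Prop_irrelevance.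
Qed.

Lemma opD A x y : A (x + y) = A x + A y.
Proof. by have := op_lin A 1 x y; rewrite !scale1r. Qed.

Lemma op0 A : A 0 = 0.
Proof. by apply: (addrI (A 0)); rewrite -opD !addr0. Qed.

Lemma opZ A a x : A (a *: x) = a *: A x.
Proof. by have := op_lin A a x 0; rewrite op0 !addr0. Qed.

Lemma opN A x : A (- x) = - A x.
Proof. by rewrite -scaleN1r opZ scaleN1r. Qed.

Lemma opB A x y : A (x - y) = A x - A y.
Proof. by rewrite opD opN. Qed.

Let adjointE A := op_adjP A.

Program Definition op_star A : Op := @AdjOp hip (op_adj A) A _ _.
Next Obligation.
move=> A a x y; apply: (ip_inj hip) => z.
by rewrite -adjointE !(ipDr hip) !(ipZr hip) -!adjointE.
Qed.
Next Obligation.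
by move=> A x y; rewrite (ipC hip) -adjointE -(ipC hip).
Qed.

Program Definition op_addm A B : Op :=
  @AdjOp hip (fun x => A x + B x) (fun x => op_adj A x + op_adj B x) _ _.
Next Obligation.
by move=> A B a x y /=; rewrite !op_lin scalerDr addrACA.
Qed.
Next Obligation.
by move=> A B x y /=; rewrite (ipDl hip) (ipDr hip) !adjointE.
Qed.

Program Definition op_oppm A : Op :=
  @AdjOp hip (fun x => - A x) (fun x => - op_adj A x) _ _.
Next Obligation. by move=> A a x y /=; rewrite op_lin opprD scalerN. Qed.
Next Obligation. by move=> A x y /=; rewrite (ipNl hip) (ipNr hip) adjointE. Qed.

Program Definition op_zero : Op := @AdjOp hip (fun=> 0) (fun=> 0) _ _.
Next Obligation. by move=> a x y /=; rewrite scaler0 addr0. Qed.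
Next Obligation. by move=> x y /=; rewrite (ip0l hip) (ip0r hip). Qed.

Program Definition op_id : Op := @AdjOp hip id id _ _.
Next Obligation. by []. Qed.
Next Obligation. by []. Qed.

Program Definition op_comp A B : Op :=
  @AdjOp hip (fun x => A (B x)) (fun x => op_adj B (op_adj A x)) _ _.
Next Obligation. by move=> A B a x y /=; rewrite !op_lin. Qed.
Next Obligation. by move=> A B x y /=; rewrite !adjointE. Qed.

Program Definition op_scale (a : R[i]) A : Op :=
  @AdjOp hip (fun x => a *: A x) (fun x => conjc a *: op_adj A x) _ _.
Next Obligation.
by move=> a A b x y /=; rewrite op_lin scalerDr !scalerA mulrC.
Qed.
Next Obligation.
by move=> a A x y /=; rewrite (ipZl hip) (ipZr hip) conjcK adjointE.
Qed.

HB.instance Definition _ := gen_eqMixin Op.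
HB.instance Definition _ := gen_choiceMixin Op.

Fact op_addA : associative op_addm.
Proof. by move=> A B D; apply: op_ext => x /=; rewrite addrA. Qed.
Fact op_addC : commutative op_addm.
Proof. by move=> A B; apply: op_ext => x /=; rewrite addrC. Qed.
Fact op_add0 : left_id op_zero op_addm.
Proof. by move=> A; apply: op_ext => x /=; rewrite add0r. Qed.
Fact op_addN : left_inverse op_zero op_oppm op_addm.
Proof. by move=> A; apply: op_ext => x /=; rewrite addNr. Qed.
HB.instance Definition _ :=
  GRing.isZmodule.Build Op op_addA op_addC op_add0 op_addN.

Fact op_mulA : associative op_comp. Proof. by move=> A B D; apply: op_ext. Qed.
Fact op_mul1 : left_id op_id op_comp. Proof. by move=> A; apply: op_ext. Qed.
Fact op_mulr1 : right_id op_id op_comp. Proof. by move=> A; apply: op_ext. Qed.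
Fact op_mulDl : left_distributive op_comp +%R.
Proof. by move=> A B D; apply: op_ext. Qed.
Fact op_mulDr : right_distributive op_comp +%R.
Proof. by move=> A B D; apply: op_ext => x /=; rewrite opD. Qed.
HB.instance Definition _ :=
  GRing.Zmodule_isPzRing.Build Op op_mulA op_mul1 op_mulr1 op_mulDl op_mulDr.

Fact op_scaleA a b A : op_scale a (op_scale b A) = op_scale (a * b) A.
Proof. by apply: op_ext => x /=; rewrite scalerA. Qed.
Fact op_scale1 : left_id 1 op_scale.
Proof. by move=> A; apply: op_ext => x /=; rewrite scale1r. Qed.
Fact op_scaleDr : right_distributive op_scale +%R.
Proof. by move=> a A B; apply: op_ext => x /=; rewrite scalerDr. Qed.
Fact op_scaleDl A : {morph op_scale^~ A : a b / a + b}.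
Proof. by move=> a b; apply: op_ext => x /=; rewrite scalerDl. Qed.
HB.instance Definition _ :=
  GRing.Zmodule_isLmodule.Build R[i] Op op_scaleA op_scale1 op_scaleDr op_scaleDl.

Lemma addopE A B x : (A + B) x = A x + B x. Proof. by []. Qed.
Lemma oppopE A x : (- A) x = - A x. Proof. by []. Qed.
Lemma mulopE A B x : (A * B) x = A (B x). Proof. by []. Qed.
Lemma oneopE x : (1 : Op) x = x. Proof. by []. Qed.
Lemma zeroopE x : (0 : Op) x = 0. Proof. by []. Qed.
Lemma scaleopE a A x : (a *: A) x = a *: A x. Proof. by []. Qed.
Definition opE := (addopE, oppopE, mulopE, oneopE, zeroopE, scaleopE).

Lemma mulopZl a A B : (a *: A) * B = a *: (A * B).
Proof. exact: op_ext. Qed.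

Lemma mulopZr a A B : A * (a *: B) = a *: (A * B).
Proof. by apply: op_ext => x; rewrite !opE opZ. Qed.

Lemma commZ a A B : GRing.comm A B -> GRing.comm A (a *: B).
Proof. by rewrite /GRing.comm mulopZl mulopZr => ->. Qed.

Lemma expopE A m x : (A ^+ m) x = iter m A x.
Proof. by elim: m x => // m IH x; rewrite exprS mulopE IH. Qed.

Local Notation "A '^s'" := (op_star A) (at level 2, format "A '^s'").

Lemma ip_star A x y : ip (A x) y = ip x (A^s y).
Proof. exact: adjointE. Qed.

Lemma ip_starr A x y : ip x (A y) = ip (A^s x) y.
Proof. by rewrite ip_star; congr ip; case: A. Qed.

Lemma starK : involutive op_star.
Proof. by move=> A; exact: op_ext. Qed.

Lemma starD A B : (A + B)^s = A^s + B^s. Proof. exact: op_ext. Qed.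
Lemma starN A : (- A)^s = - A^s. Proof. exact: op_ext. Qed.
Lemma starM A B : (A * B)^s = B^s * A^s. Proof. exact: op_ext. Qed.
Lemma star1 : (1 : Op)^s = 1. Proof. exact: op_ext. Qed.
Lemma starZ a A : (a *: A)^s = conjc a *: A^s. Proof. exact: op_ext. Qed.
Lemma starX A m : (A ^+ m)^s = A^s ^+ m.
Proof. by elim: m => [|m IH]; rewrite ?star1 // exprS starM IH -exprSr. Qed.

Lemma comm_star A B : GRing.comm A B -> GRing.comm A^s B^s.
Proof. by rewrite /GRing.comm -!starM => ->. Qed.

End AdjointableOperators.
(** * Fuglede's theorem *)

Section CauchyEstimate.
Set Implicit Arguments.
Unset Strict Implicit.
Variable C : numClosedFieldType.
Implicit Types (p : {poly C}) (r K : C).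

(** Averaging over [z] and [- z] leaves the even part, a polynomial in [z ^+ 2] of half the size
    with the same constant term and the same bound on the circle of radius [r ^+ 2]. After [s]
    halvings it is constant. *)
Lemma coef0_circle_bound s p r K : (size p <= 2 ^ s)%N -> 0 <= r ->
  (forall z, `|z| = r -> `|p.[z]| <= K) -> `|p`_0| <= K.
Proof.
elim: s p r => [|s IH] p r sp r0 h.
  have := h r (ger0_norm r0).
  by rewrite (size1_polyC sp) hornerC coefC.
have e0 : (even_poly p)`_0 = p`_0 by rewrite coef_even_poly.
rewrite -e0; apply: (IH _ (r ^+ 2)).
- rewrite (leq_trans (size_even_poly _)) // leq_uphalf_double.
  by rewrite -mul2n -expnS.
- exact: exprn_ge0.
move=> w wr; pose z := sqrtC w.
have zw : z ^+ 2 = w by rewrite sqrtCK.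
have zr : `|z| = r.
  by apply/eqP; rewrite -(@eqrXn2 _ 2) // -normrX zw wr.
have pE u : p.[u] = (even_poly p).[u ^+ 2] + (odd_poly p).[u ^+ 2] * u.
  by rewrite -{1}[p]poly_even_odd !(hornerE, horner_comp).
have -> : (even_poly p).[w] = (p.[z] + p.[- z]) / 2.
  by rewrite !pE sqrrN zw; field.
rewrite normrM normfV [`|2|]ger0_norm // ler_pdivrMr ?ltr0n //.
rewrite (le_trans (ler_normD _ _)) // mulr_natr mulr2n lerD // h //.
by rewrite normrN.
Qed.

(** The coefficient is the constant term of the odd part, whose value at [z ^+ 2] is (p(z) - p(-z))
    / (2z), hence at most [K / r]. *)
Lemma coef1_circle_bound p r K : 0 < r ->
  (forall z, `|z| = r -> `|p.[z]| <= K) -> `|p`_1| <= K / r.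
Proof.
move=> r0 h.
have e0 : (odd_poly p)`_0 = p`_1 by rewrite coef_odd_poly.
rewrite -e0; apply: (@coef0_circle_bound (size (odd_poly p)) _ (r ^+ 2)).
- exact/ltnW/ltn_expl.
- exact/exprn_ge0/ltW.
move=> w wr; pose z := sqrtC w.
have zw : z ^+ 2 = w by rewrite sqrtCK.
have zr : `|z| = r.
  by apply/eqP; rewrite -(@eqrXn2 _ 2) // ?(ltW r0) // -normrX zw wr.
have z0 : z != 0 by rewrite -normr_gt0 zr.
have pE u : p.[u] = (even_poly p).[u ^+ 2] + (odd_poly p).[u ^+ 2] * u.
  by rewrite -{1}[p]poly_even_odd !(hornerE, horner_comp).
have -> : (odd_poly p).[w] = (p.[z] - p.[- z]) / 2 / z.
  by rewrite !pE sqrrN zw; field.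
rewrite !normrM !normfV zr ler_pM2r ?invr_gt0 //.
rewrite [`|2|]ger0_norm // ler_pdivrMr ?ltr0n //.
rewrite (le_trans (ler_normB _ _)) // mulr_natr mulr2n lerD // h //.
by rewrite normrN.
Qed.

End CauchyEstimate.

(** * Numerical estimates for (1 + c/N)^N *)

Section Bernoulli.
Set Implicit Arguments.
Unset Strict Implicit.
Variable R : realType.

Lemma bernoulli_inv (x : R) q : 0 <= x -> q%:R * x <= 2^-1 ->
  (1 + x) ^+ q <= 1 + 2 * q%:R * x.
Proof.
move=> x0; elim: q => [|q IH] h; first by rewrite expr0 mulr0 mul0r addr0.
have hq : q%:R * x <= 2^-1 by apply: le_trans h; rewrite ler_wpM2r // ler_nat.
have {}IH := IH hq.
rewrite exprSr (le_trans (ler_wpM2r _ IH)) ?addr_ge0 //.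
rewrite -natr1; have : 0 <= (2^-1 - q%:R * x) * x by rewrite mulr_ge0 // subr_ge0.
by lra.
Qed.

(** As N grows, (1 + c^2/N^2)^N - 1 is of order 1/N while (1 + c/N)^(2N) stays bounded. *)
Lemma exp_limit_bounds (c : R) : 0 <= c -> exists2 N : nat, (0 < N)%N &
  (1 + (c / N%:R) ^+ 2) ^+ N <= 2 /\
  (1 + c / N%:R) ^+ (N + N) * ((1 + (c / N%:R) ^+ 2) ^+ N - 1) <= 1.
Proof.
(* With N = Kq and K at least 2c, (1 + c/N)^q is at most 2, so (1 + c/N)^(2N) is at most 4^K,
   whatever q is. *)
move=> c0; pose K := (Num.bound (2 * c)).+1.
have Kc : 2 * c <= K%:R.
  by rewrite (le_trans (ltW (archi_boundP _))) ?mulr_ge0 // ler_nat.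
(* This size of q makes 2c^2/N, which bounds (1 + c^2/N^2)^N - 1, at most 4^(-K). *)
pose q := (Num.bound (4 ^+ K * (2 * c ^+ 2))).+1.
have qc : 4 ^+ K * (2 * c ^+ 2) <= q%:R.
  rewrite (le_trans (ltW (archi_boundP _))) ?ler_nat //.
  by rewrite mulr_ge0 ?exprn_ge0 ?ler0n // mulr_ge0 ?exprn_ge0 ?ler0n.
have q0 : 0 < q%:R :> R by rewrite ltr0n.
have K0 : 0 < K%:R :> R by rewrite ltr0n.
pose N := (K * q)%N; have N0 : (0 < N)%N by rewrite muln_gt0.
have NE : N%:R = K%:R * q%:R :> R by rewrite natrM.
have rN0 : 0 < N%:R :> R by rewrite ltr0n.
have Nq : q%:R <= N%:R :> R by rewrite ler_nat leq_pmull.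
exists N => //.
have e1 : N%:R * (c / N%:R) ^+ 2 = c ^+ 2 / N%:R.
  by field; rewrite ?pnatr_eq0 -?lt0n ?muln_gt0 ?lt0r_neq0 // ltr0n.

have k1 : 1 <= 4 ^+ K :> R by apply: exprn_ege1; lra.
have e2 : 4 ^+ K * (2 * (c ^+ 2 / N%:R)) <= 1.
  have -> : 4 ^+ K * (2 * (c ^+ 2 / N%:R)) = 4 ^+ K * (2 * c ^+ 2) / N%:R.
    by rewrite !mulrA.
  by rewrite ler_pdivrMr // mul1r (le_trans qc).
have e3 : 2 * (c ^+ 2 / N%:R) <= 1.
  have cN2 : 0 <= c ^+ 2 / N%:R by rewrite divr_ge0 ?exprn_ge0 ?ler0n.
  by apply: le_trans e2; rewrite ler_peMl // mulr_ge0 ?ler0n.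
have b1 : (1 + (c / N%:R) ^+ 2) ^+ N <= 1 + 2 * (c ^+ 2 / N%:R).
  rewrite -e1 mulrA; apply: bernoulli_inv; first exact: sqr_ge0.
  by rewrite e1; lra.
have b2 : (1 + c / N%:R) ^+ (N + N) <= 4 ^+ K.
  have -> : (N + N = q * (2 * K))%N by rewrite addnn -mul2n /N mulnA mulnC.
  have -> : 4 = 2 ^+ 2 :> R by rewrite -natrX.
  rewrite !exprM.
  have cN : 0 <= c / N%:R by rewrite divr_ge0 // ltW.
  have h2 : (1 + c / N%:R) ^+ q <= 2.
    have e4 : q%:R * (c / N%:R) = c / K%:R.
      by rewrite NE; field; rewrite !lt0r_neq0.
    have e5 : c / K%:R <= 2^-1 by rewrite ler_pdivrMr //; lra.
    rewrite (le_trans (bernoulli_inv _ _)) ?e4 //.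
    by rewrite -mulrA e4; lra.
  rewrite ler_pXn2r ?nnegrE ?exprn_ge0 ?addr_ge0 //.
  by rewrite ler_pXn2r ?nnegrE ?exprn_ge0 ?addr_ge0.
split; first by apply: le_trans b1 _; lra.
apply: le_trans e2; apply: ler_pM => //.
- by rewrite exprn_ge0 // addr_ge0 // divr_ge0 // ltW.
- by rewrite subr_ge0 exprn_ege1 // lerDl sqr_ge0.
- by rewrite lerBlDl.
Qed.

End Bernoulli.

(** * Upper bounds for operator norms *)

Section OperatorBounds.
Set Implicit Arguments.
Unset Strict Implicit.
Variables (R : realType) (V : lmodType R[i]) (ip : V -> V -> R[i]).
Variable hip : inner_product ip.
Local Notation Op := (adjop hip).
Local Notation nrm := (hnorm ip).
Local Notation "A '^s'" := (op_star A) (at level 2, format "A '^s'").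
Implicit Types (A B M T U : Op) (a b c m t : R) (x y : V).

Definition opbound c A := forall x, nrm (A x) <= c * nrm x.

Lemma opbound_le a b A : a <= b -> opbound a A -> opbound b A.
Proof.
by move=> ab h x; rewrite (le_trans (h x)) // ler_wpM2r // hnorm_ge0.
Qed.

Lemma opboundM a b A B : 0 <= a -> opbound a A -> opbound b B ->
  opbound (a * b) (A * B).
Proof.
move=> a0 hA hB x; rewrite !opE (le_trans (hA _)) // -mulrA ler_wpM2l //.
Qed.

Lemma opboundD a b A B : opbound a A -> opbound b B -> opbound (a + b) (A + B).
Proof.
by move=> hA hB x; rewrite !opE (le_trans (hnormD hip _ _)) // mulrDl lerD.
Qed.

Lemma opboundN a A : opbound a A -> opbound a (- A).
Proof. by move=> hA x; rewrite !opE hnormN. Qed.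

Lemma opbound1 : opbound 1 1.
Proof. by move=> x; rewrite !opE mul1r. Qed.

Lemma opboundX c A k : 0 <= c -> opbound c A -> opbound (c ^+ k) (A ^+ k).
Proof.
move=> c0 h; elim: k => [|k IH]; first exact: opbound1.
by rewrite !exprS; apply: opboundM.
Qed.

Lemma opboundZ (z : R[i]) r c A : `|z| = r%:C -> opbound c A ->
  opbound (r * c) (z *: A).
Proof.
move=> zr h x; rewrite opE -lecR (hnormZ hip) zr -rmorphM lecR -mulrA.
by rewrite ler_wpM2l // -ler0c -zr normr_ge0.
Qed.

(** One half of the C*-identity: |Ax|^2 = <x, A^s A x>, then Cauchy-Schwarz. *)
Lemma opbound_sqr c A : 0 <= c -> opbound (c ^+ 2) (A^s * A) -> opbound c A.
Proof.
move=> c0 h x.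
rewrite -(@ler_pXn2r _ 2) ?nnegrE ?mulr_ge0 ?hnorm_ge0 //.
rewrite (hnorm2E hip) ip_starr -Re_ipC // exprMn.
have := h x; rewrite opE => hx.
have := Re_cauchy_schwarz hip x (A^s (A x)).
rewrite ler_norml => /andP[_] /le_trans; apply.
by rewrite mulrC expr2 mulrA ler_wpM2r ?hnorm_ge0.
Qed.

Lemma opbound_star c A : 0 <= c -> opbound c A -> opbound c A^s.
Proof.
move=> c0 h x; have [->|nz] := eqVneq (nrm (A^s x)) 0.
  by rewrite mulr_ge0 ?hnorm_ge0.
have np : 0 < nrm (A^s x) by rewrite lt_neqAle eq_sym nz hnorm_ge0.
rewrite -(ler_pM2r np) -expr2 (hnorm2E hip) -ip_star.
have := Re_cauchy_schwarz hip (A (A^s x)) x.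
rewrite ler_norml => /andP[_] /le_trans; apply.
rewrite mulrAC ler_wpM2r ?hnorm_ge0 //; exact: h.
Qed.

(** Telescoping: 1 - A^(k+1) = (1 - A^k) + A^k (1 - A), and (1 + c)^k - 1 obeys the same
    recursion. *)
Lemma opbound_subX1 c A k : 0 <= c -> opbound c (1 - A) ->
  opbound ((1 + c) ^+ k - 1) (1 - A ^+ k).
Proof.
move=> c0 h.
have hA : opbound (1 + c) A.
  by rewrite -[A](subKr 1); apply: opboundD; [exact: opbound1|exact: opboundN].
elim: k => [|k IH].
  by rewrite !expr0 !subrr => x; rewrite !opE hnorm0 // mul0r.
have -> : 1 - A ^+ k.+1 = (1 - A ^+ k) + A ^+ k * (1 - A).
  by rewrite mulrBr mulr1 -exprSr addrA addrNK.
have -> : (1 + c) ^+ k.+1 - 1 = (1 + c) ^+ k - 1 + (1 + c) ^+ k * c.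
  by rewrite exprSr; ring.
apply: opboundD => //; apply: opboundM => //.
  by rewrite exprn_ge0 // addr_ge0.
by apply: opboundX => //; rewrite addr_ge0.
Qed.

End OperatorBounds.

(** * The conjugated operator as a polynomial in z, and Liouville's argument *)

Section Fuglede.
Set Implicit Arguments.
Unset Strict Implicit.
Variables (R : realType) (V : lmodType R[i]) (ip : V -> V -> R[i]).
Variable hip : inner_product ip.
Local Notation Op := (adjop hip).
Local Notation "A '^s'" := (op_star A) (at level 2, format "A '^s'").
Implicit Types (A B M T U : Op) (a b c m t : R) (x y : V).

Lemma mul_add1_sub1 A : (1 + A) * (1 - A) = 1 - A ^+ 2.
Proof. by rewrite mulrDl mul1r mulrBr mulr1 expr2 addrA addrNK. Qed.

Lemma mul_sub1_add1 A : (1 - A) * (1 + A) = 1 - A ^+ 2.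
Proof. by rewrite mulrBl mul1r mulrDr mulr1 opprD addrA addrK. Qed.

(* The product approximates the unitary operator exp(U - U^* ). *)
Lemma opbound_cayley U c : 0 <= c -> GRing.comm U U^s -> opbound c U ->
  opbound (1 + c ^+ 2) ((1 + U) * (1 - U^s)).
Proof.
move=> c0 cU hU; apply: opbound_sqr; first by rewrite addr_ge0 ?sqr_ge0.
have hs := opbound_star c0 hU.
(* Normality of U lets the factors pair up so that the linear terms cancel; only errors of order c^2
   survive. *)
have -> : ((1 + U) * (1 - U^s))^s * ((1 + U) * (1 - U^s)) =
   (1 - U ^+ 2) * (1 - U^s ^+ 2).
  rewrite starM !starD starN starK star1.
  have c1 : GRing.comm (1 + U^s) (1 + U).
    by apply: commrD; [exact: commr1|apply/commr_sym/commrD; [exact: commr1|]].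
  rewrite -mulrA (mulrA (1 + U^s)) c1 -mulrA mulrA.
  by rewrite mul_sub1_add1 mul_add1_sub1.
rewrite [_ ^+ 2 in X in opbound X]expr2; apply: opboundM.
- by rewrite addr_ge0 ?sqr_ge0.
- by apply: opboundD; [exact: opbound1|apply: opboundN; exact: opboundX].
- by apply: opboundD; [exact: opbound1|apply: opboundN; exact: opboundX].
Qed.

(* With A = (1+U)(1-U^* ) and A' = (1+U^* )(1-U), the operator A^N T A'^N equals
   (1+U)^N T (1-U^*^2)^N (1-U)^N because T commutes with U^*. *)
Lemma opbound_conj_expansion U T c t N : 0 <= c -> 0 <= t ->
  GRing.comm U U^s -> GRing.comm T U^s -> opbound c U -> opbound t T ->
  opbound ((1 + c ^+ 2) ^+ N * t * (1 + c ^+ 2) ^+ N +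
           (1 + c) ^+ N * t * ((1 + c ^+ 2) ^+ N - 1) * (1 + c) ^+ N)
    ((1 + U) ^+ N * T * (1 - U) ^+ N).
Proof.
move=> c0 t0 cU cT hU hT; have hs := opbound_star c0 hU.
have cc0 : 0 <= 1 + c ^+ 2 by rewrite addr_ge0 ?sqr_ge0.
have c10 : 0 <= 1 + c by rewrite addr_ge0.
set A := (1 + U) * (1 - U^s); set A' := (1 + U^s) * (1 - U).
have hA : opbound (1 + c ^+ 2) A by exact: opbound_cayley.
have c1 : GRing.comm (1 + U^s) (1 - U).
  apply: commrB; first exact: commr1.
  by apply/commr_sym/commrD => //; exact: commr1.
have hA' : opbound (1 + c ^+ 2) A'.
  have -> : A' = (1 + - U) * (1 - (- U)^s) by rewrite starN opprK /A' c1.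
  apply: opbound_cayley => //; last exact: opboundN.
  by rewrite starN; apply/commrN/commr_sym/commrN/commr_sym.
have c2 : GRing.comm (1 + U) (1 - U^s).
  apply/commr_sym; apply: commrD; first exact: commr1.
  by apply/commr_sym; apply: commrB => //; exact: commr1.
have cTm : GRing.comm T (1 - U^s) by apply: commrB => //; exact: commr1.
(* The first summand carries an extra factor [(1 - U^s ^+ 2) ^+ N], which is close to 1; the second
   is the error of replacing it by 1. *)
have -> : (1 + U) ^+ N * T * (1 - U) ^+ N =
  A ^+ N * T * A' ^+ N +
  (1 + U) ^+ N * T * (1 - (1 - U^s ^+ 2) ^+ N) * (1 - U) ^+ N.
  rewrite /A /A' !exprMn_comm // (mulrBr _ 1) mulr1 mulrBl addrCA.
  rewrite -[X in X = _]addr0; congr (_ + _).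
  apply/eqP; rewrite eq_sym subr_eq0; apply/eqP.
  rewrite -!mulrA; congr (_ * _); rewrite mulrA -(commrX _ cTm) -mulrA.
  congr (_ * _); rewrite mulrA -exprMn_comm; last first.
    apply/commr_sym; apply: commrB; first exact: commr1.
    by apply/commr_sym/commrD => //; exact: commr1.
  congr (_ ^+ _ * _).
  exact: mul_sub1_add1.
apply: opboundD; apply: opboundM.
- by rewrite mulr_ge0 // exprn_ge0.
- by apply: opboundM => //; [rewrite exprn_ge0|exact: opboundX].
- exact: opboundX.
- rewrite mulr_ge0 ?mulr_ge0 ?exprn_ge0 // subr_ge0.
  by rewrite exprn_ege1 // lerDl sqr_ge0.
- apply: opboundM; [by rewrite mulr_ge0 ?exprn_ge0| |].
    apply: opboundM => //; first by rewrite exprn_ge0.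
    by apply: opboundX => //; apply: opboundD => //; exact: opbound1.
  apply: opbound_subX1; first exact: sqr_ge0.
  by rewrite subKr; exact: opboundX.
- apply: opboundX => //; apply: opboundD; first exact: opbound1.
  exact: opboundN.
Qed.

(** The exponents are independent so that the induction can peel off one factor at a time; a left
    factor passes to [y] through its adjoint. With i = j = N and U = M^s / N, the first coefficient
    is that of the commutator of M^s and T. *)
Lemma conj_expansion_poly U T i j x y : exists p : {poly R[i]},
  [/\ forall z, ip (((1 + z *: U) ^+ i * T * (1 - z *: U) ^+ j) x) y = p.[z],
      p`_0 = ip (T x) y &
      p`_1 = ip (((U * T) *+ i - (T * U) *+ j) x) y].
Proof.
elim: i x y => [|i IH] x y.
  elim: j x => [|j IH] x.
    exists (ip (T x) y)%:P; split=> [z||].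
    - by rewrite !expr0 mulr1 mul1r hornerC.
    - by rewrite coefC.
    - by rewrite coefC !mulr0n subrr opE (ip0l hip).
  have [p [pz p0 p1]] := IH x; have [q [qz q0 q1]] := IH (U x).
  exists (p - q * 'X); split=> [z||].
  - rewrite !hornerE -pz -qz exprSr mulrA mulrBr mulr1 mulopZr !opE.
    by rewrite (ipDl hip) (ipNl hip) (ipZl hip) mulrC.
  - by rewrite coefB coefMX /= subr0.
  - have -> : (p - q * 'X)`_1 = p`_1 - q`_0 by rewrite coefB coefMX.
    by rewrite p1 q0 !mulr0n !sub0r mulrSr opprD !opE (ipDl hip) !(ipNl hip).
have [p [pz p0 p1]] := IH x y; have [q [qz q0 q1]] := IH x (U^s y).
exists (p + q * 'X); split=> [z||].
- rewrite !hornerE -pz -qz exprS -!mulrA mulrDl mul1r mulopZl !opE.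
  by rewrite (ipDl hip) (ipZl hip) -ip_star mulrC.
- by rewrite coefD coefMX /= addr0.
- have -> : (p + q * 'X)`_1 = p`_1 + q`_0 by rewrite coefD coefMX.
  by rewrite p1 q0 -ip_star mulrSr addrAC [in RHS]addopE (ipDl hip).
Qed.

(** The main term is at most 2 * 2 * t and the error term at most t, whence the 5. *)
Let five_bound e f t : 0 <= t -> 0 <= e -> e <= 2 -> f * f * (e - 1) <= 1 ->
  e * t * e + f * t * (e - 1) * f <= 5 * t.
Proof.
move=> t0 e0 e2 b2; have h1 : e * e <= 2 * 2 by apply: ler_pM.
have := ler_wpM2l t0 b2; have := ler_wpM2l t0 h1; lra.
Qed.

(** N is chosen in terms of r, yet the bound 5t|x||y| for the polynomial on the circle is free of r;
    Cauchy's estimate then brings the factor 1/r. *)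
Lemma commutator_circle_bound M T m t r x y : 0 <= m -> 0 <= t -> 0 < r ->
  GRing.comm M M^s -> GRing.comm T M -> opbound m M -> opbound t T ->
  `|ip ((M^s * T - T * M^s) x) y| <=
    (5 * t * hnorm ip x * hnorm ip y / r)%:C.
Proof.
move=> m0 t0 r0 cM cT hM hT.
have [N N0 [b1 b2]] := exp_limit_bounds (mulr_ge0 (ltW r0) m0).
set c := r * m / N%:R in b1 b2.
have Np : 0 < N%:R :> R by rewrite ltr0n.
have c0 : 0 <= c by rewrite divr_ge0 ?ler0n // mulr_ge0 // ltW.
pose U := (N%:R^-1)%:C *: M^s.
have [p [pz p0 p1]] := conj_expansion_poly U T N N x y.
have NN : N%:R * (N%:R^-1)%:C = 1 :> R[i].
  by rewrite -(rmorph_nat (real_complex R)) -rmorphM /= divff ?rmorph1 ?lt0r_neq0.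
have -> : ip ((M^s * T - T * M^s) x) y = p`_1.
  rewrite p1 /U mulopZl mulopZr -mulrnBl -scalerBr.
  move: (M^s * T - T * M^s) => D.
  by rewrite -(scaler_nat N) scalerA NN scale1r.
have rC : 0 < r%:C :> R[i] by rewrite ltcR.
have -> : (5 * t * hnorm ip x * hnorm ip y / r)%:C =
  (5 * t * hnorm ip x * hnorm ip y)%:C / r%:C :> R[i].
  by rewrite rmorphM fmorphV.
apply: coef1_circle_bound => // z zr; rewrite -pz.
rewrite (le_trans (cauchy_schwarz hip _ _)) // lecR ler_wpM2r ?hnorm_ge0 //.
have hM' := opbound_star m0 hM.
have hU : opbound c (z *: U).
  have -> : c = r * (N%:R^-1 * m) by rewrite /c; ring.
  apply: opboundZ => //; apply: opboundZ => //.
  by rewrite ger0_norm ?ler0c ?invr_ge0 ?ler0n.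
have UsE : (z *: U)^s = (conjc z * (N%:R^-1)%:C) *: M.
  by rewrite /U !starZ starK scalerA conjc_real.
have cU : GRing.comm (z *: U) (z *: U)^s.
  rewrite UsE; apply/commZ/commr_sym/commZ/commZ.
  exact: cM.
have cTU : GRing.comm T (z *: U)^s by rewrite UsE; apply: commZ.
clearbody c; rewrite exprD in b2.
apply: (opbound_le _ (opbound_conj_expansion N c0 t0 cU cTU hU hT)).
apply: five_bound => //.
by rewrite exprn_ge0 // addr_ge0 ?sqr_ge0.
Qed.

Theorem fuglede M T m t : 0 <= m -> 0 <= t ->
  GRing.comm M M^s -> GRing.comm T M -> opbound m M -> opbound t T ->
  GRing.comm T M^s.
Proof.
move=> m0 t0 cM cT hM hT; apply/eqP; rewrite eq_sym -subr_eq0; apply/eqP.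
apply: op_ext => x; apply: (ip_inj hip) => z; rewrite (ipC hip) (ipC hip z).
congr conjc; rewrite [RHS](ip0l hip).
apply/eqP; rewrite -normr_le0; set D := `|_|.
have [d Dd d0] : exists2 d, D = d%:C & 0 <= d.
  have D0 : 0 <= D by exact: normr_ge0.
  have DE : D = (Re D)%:C by rewrite RRe_real // ger0_real.
  by exists (Re D) => //; rewrite -ler0c -DE.
rewrite Dd (lecR d 0) leNgt; apply/negP => dp.
set K := 5 * t * hnorm ip x * hnorm ip z.
have K0 : 0 <= K by rewrite /K !mulr_ge0 ?hnorm_ge0.
(* At this radius the estimate reads d <= K d / (K + 1), which is false for d > 0. *)
have r0 : 0 < (K + 1) / d by rewrite divr_gt0 // ltr_wpDl.
have := commutator_circle_bound x z m0 t0 r0 cM cT hM hT.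
rewrite -/D Dd lecR -/K invf_div mulrA ler_pdivlMr ?ltr_wpDl //.
by rewrite mulrDr mulr1 mulrC gerDl leNgt dp.
Qed.

End Fuglede.
(** * Nonnegative operators and Bernstein approximation *)

Section NonnegativeOperators.
Set Implicit Arguments.
Unset Strict Implicit.
Variables (R : realType) (V : lmodType R[i]) (ip : V -> V -> R[i]).
Variable hip : inner_product ip.
Local Notation Op := (adjop hip).
Local Notation nrm := (hnorm ip).
Local Notation "A '^s'" := (op_star A) (at level 2, format "A '^s'").
Implicit Types (A B D W X : Op) (a b c : R) (x y : V).

Definition opform A x : R := Re (ip (A x) x).
(** Only the real part of the quadratic form is constrained; self-adjointness is a separate
    hypothesis where it is used. *)
Definition opnneg A := forall x, 0 <= opform A x.

Lemma opformD A B x : opform (A + B) x = opform A x + opform B x.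
Proof. by rewrite /opform !opE (ipDl hip) Re_add. Qed.

Lemma opformN A x : opform (- A) x = - opform A x.
Proof. by rewrite /opform !opE (ipNl hip) Re_opp. Qed.

Lemma opformB A B x : opform (A - B) x = opform A x - opform B x.
Proof. by rewrite opformD opformN. Qed.

Lemma opformZ a A x : opform (a%:C *: A) x = a * opform A x.
Proof. by rewrite /opform !opE (ipZl hip) Re_scale. Qed.

Lemma opform1 x : opform 1 x = nrm x ^+ 2.
Proof. by rewrite (hnorm2E hip). Qed.

Lemma opform_star_mul A x : opform (A^s * A) x = nrm (A x) ^+ 2.
Proof. by rewrite (hnorm2E hip) /opform mulopE -ip_starr. Qed.

Lemma opform_conj A B x : opform (B^s * A * B) x = opform A (B x).
Proof. by rewrite /opform !mulopE ip_star starK. Qed.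

Lemma opnneg_star_mul A : opnneg (A^s * A).
Proof. by move=> x; rewrite opform_star_mul sqr_ge0. Qed.

Lemma opnneg1 : opnneg 1.
Proof. by move=> x; rewrite opform1 sqr_ge0. Qed.

Lemma opnnegD A B : opnneg A -> opnneg B -> opnneg (A + B).
Proof. by move=> hA hB x; rewrite opformD addr_ge0. Qed.

Lemma opnneg_conj A B : opnneg A -> opnneg (B^s * A * B).
Proof. by move=> hA x; rewrite opform_conj. Qed.

Lemma opnneg_sqr_mul A B : B^s = B -> GRing.comm A B -> opnneg A ->
  opnneg (B ^+ 2 * A).
Proof.
move=> sB cAB hA; rewrite expr2 -mulrA -cAB mulrA -{1}sB; exact: opnneg_conj.
Qed.

Definition unit_interval_op B := [/\ B^s = B, opnneg B & opnneg (1 - B)].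

(** B - B^2 = (1-B) B (1-B) + B (1-B) B, and 1 - (B - B^2) = (1 - B) + B^2. *)
Lemma unit_interval_subsqr B : unit_interval_op B -> unit_interval_op (B - B ^+ 2).
Proof.
case=> sB B0 B1; have s1B : (1 - B)^s = 1 - B by rewrite starD star1 starN sB.
have c1 : GRing.comm B (1 - B) by apply: commrB => //; exact: commr1.
split.
- by rewrite starD starN starX sB.
- have -> : B - B ^+ 2 = (1 - B) ^+ 2 * B + B ^+ 2 * (1 - B).
    rewrite !expr2 -[(1 - B) * _ * B]mulrA -c1 mulrA -c1 -!mulrA -mulrDr.
    by rewrite -mulrDl subrK mul1r mulrBr mulr1.
  by apply: opnnegD; apply: opnneg_sqr_mul => //; exact: commr_sym.
- rewrite opprB addrCA addrC; apply: opnnegD => //.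
  by rewrite expr2 -{1}sB; exact: opnneg_star_mul.
Qed.

(* F. Riesz: B = sum_i B_i^2 strongly, where B_0 = B and B_(i+1) = B_i - B_i^2;
   hence A B = sum_i B_i A B_i. *)
Lemma opnneg_mul A B : opnneg A -> GRing.comm A B -> unit_interval_op B ->
  opnneg (A * B).
Proof.
move=> hA cAB hB x; pose Bs i := iter i (fun D => D - D ^+ 2) B.
have hBs i : unit_interval_op (Bs i).
  by elim: i => //= i; exact: unit_interval_subsqr.
have cBs i : GRing.comm A (Bs i).
  by elim: i => //= i IH; apply: commrB => //; exact: commrX.
have step D i : GRing.comm D (Bs i) ->
    opform (D * Bs i) x = opform D (Bs i x) + opform (D * Bs i.+1) x.
  move=> cD; have [sB _ _] := hBs i.
  have e : D * (Bs i * Bs i) = (Bs i)^s * D * Bs i by rewrite sB mulrA cD.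
  by rewrite /= mulrBr opformB expr2 e opform_conj addrC subrK.
have lowA i : opform (A * Bs i) x <= opform (A * B) x.
  elim: i => // i; apply: le_trans; rewrite (step A i) //.
  by rewrite lerDr.
have c1 i : GRing.comm 1 (Bs i) by apply/commr_sym/commr1.
have sumB i : \sum_(j < i) nrm (Bs j x) ^+ 2 + opform (Bs i) x = opform B x.
  elim: i => [|i IH]; first by rewrite big_ord0 add0r.
  rewrite big_ord_recr /= -IH -addrA; congr (_ + _).
  by have := step 1 i (c1 i); rewrite !mul1r opform1 => ->.
(* No limit is taken: if the form were -d < 0, every term would satisfy d^2 <= K^2 |B_i x|^2, while
   the sums of |B_i x|^2 stay below the form of B at x. *)
rewrite leNgt; apply/negP => neg; set d := - opform (A * B) x.
have d0 : 0 < d by rewrite oppr_gt0.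
set K := nrm (A^s x).
have big i : d ^+ 2 <= K ^+ 2 * nrm (Bs i x) ^+ 2.
  rewrite -exprMn ler_pXn2r ?nnegrE ?mulr_ge0 ?hnorm_ge0 ?(ltW d0) //.
  have := lowA i; rewrite /opform mulopE ip_star => low.
  have := Re_cauchy_schwarz hip (Bs i x) (A^s x).
  rewrite ler_norml => /andP[h _]; rewrite -/K in h.
  by rewrite mulrC lerNl (le_trans h).
have bigsum i : i%:R * d ^+ 2 <= K ^+ 2 * opform B x.
  rewrite -(sumB i) mulrDr mulr_sumr -[leLHS]addr0; apply: lerD.
    have -> : i%:R * d ^+ 2 = \sum_(j < i) d ^+ 2.
      by rewrite sumr_const card_ord mulr_natl.
    by apply: ler_sum => j _; exact: big.
  by have [_ h _] := hBs i; rewrite mulr_ge0 ?sqr_ge0.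
have d2 : 0 < d ^+ 2 by rewrite exprn_gt0.
have B0 : 0 <= opform B x by case: hB.
have K0 : 0 <= K ^+ 2 * opform B x / d ^+ 2.
  by rewrite divr_ge0 ?(ltW d2) // mulr_ge0 ?sqr_ge0.
have := archi_boundP K0; rewrite ltr_pdivrMr // ltNge => /negP; apply.
exact: bigsum.
Qed.

(* 4 Re<Dx,y> = <D(x+y),x+y> - <D(x-y),x-y>. *)
Lemma opform_polarization D c x y : D^s = D ->
  (forall z, `|opform D z| <= c * nrm z ^+ 2) ->
  `|Re (ip (D x) y)| <= c * (nrm x ^+ 2 + nrm y ^+ 2).
Proof.
move=> sD h.
have e1 : opform D (x + y) - opform D (x - y) = 4 * Re (ip (D x) y).
  rewrite /opform opB opD !(ipDl hip) !(ipDr hip) !(ipNl hip) !(ipNr hip).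
  rewrite !(Re_add, Re_opp).
  have -> : Re (ip (D y) x) = Re (ip (D x) y) by rewrite ip_star sD Re_ipC.
  lra.
have e2 : nrm (x + y) ^+ 2 + nrm (x - y) ^+ 2 = 2 * (nrm x ^+ 2 + nrm y ^+ 2).
  rewrite !(hnorm2E hip) !(ipDl hip) !(ipDr hip) !(ipNl hip) !(ipNr hip).
  rewrite !(Re_add, Re_opp); lra.
have := h (x + y); have := h (x - y); rewrite !ler_norml.
move=> /andP[h1 h2] /andP[h3 h4].
have e3 : c * nrm (x + y) ^+ 2 + c * nrm (x - y) ^+ 2 =
  2 * (c * (nrm x ^+ 2 + nrm y ^+ 2)) by rewrite -mulrDr e2; ring.
by apply/andP; split; lra.
Qed.

End NonnegativeOperators.

(** * Bernstein sums with operator coefficients *)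

Section Bernstein.
Set Implicit Arguments.
Unset Strict Implicit.
Variables (R : realType) (V : lmodType R[i]) (ip : V -> V -> R[i]).
Variable hip : inner_product ip.
Local Notation Op := (adjop hip).
Local Notation "A '^s'" := (op_star A) (at level 2, format "A '^s'").
Variable B : Op.
Implicit Types (A X Y : Op) (f g : nat -> Op) (a c : R) (N : nat).

(* [bernstein N f] is the sum of 'C(N, m) B^m (1 - B)^(N - m) f(m) over m <= N. *)
Fixpoint bernstein N f : Op :=
  if N is N'.+1 then
    (1 - B) * bernstein N' f + B * bernstein N' (fun m => f m.+1)
  else f 0%N.

Lemma eq_bernstein N f g : f =1 g -> bernstein N f = bernstein N g.
Proof. by elim: N f g => [|N IH] f g fg /=; [|congr (_ * _ + _ * _); apply: IH => m]. Qed.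

Lemma bernsteinD N f g :
  bernstein N (fun m => f m + g m) = bernstein N f + bernstein N g.
Proof.
by elim: N f g => //= N IH f g; rewrite !IH !mulrDr addrACA.
Qed.

Lemma bernsteinZ N (a : R[i]) f :
  bernstein N (fun m => a *: f m) = a *: bernstein N f.
Proof. by elim: N f => //= N IH f; rewrite !IH !mulopZr scalerDr. Qed.

Lemma bernsteinN N f : bernstein N (fun m => - f m) = - bernstein N f.
Proof. by elim: N f => //= N IH f; rewrite !IH !mulrN opprD. Qed.

Lemma bernstein_mulr N f A :
  bernstein N (fun m => f m * A) = bernstein N f * A.
Proof. by elim: N f => //= N IH f; rewrite !IH [RHS]mulrDl !mulrA. Qed.

Lemma bernstein_const N A : bernstein N (fun=> A) = A.
Proof. by elim: N => //= N ->; rewrite -mulrDl subrK mul1r. Qed.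

(** Forward-difference form of the recursion: differencing lowers the degree in m, so the binomial
    moments follow by induction on N. *)
Lemma bernsteinS N f : bernstein N.+1 f =
  bernstein N f + B * bernstein N (fun m => f m.+1 - f m).
Proof.
rewrite /= bernsteinD bernsteinN mulrBl mul1r mulrBr -!addrA; congr (_ + _).
exact: addrC.
Qed.

Lemma bernstein_moment1 N c X :
  bernstein N (fun m => (m%:R * c)%:C *: X) = (N%:R * c)%:C *: (B * X).
Proof.
elim: N => [|N IH]; first by rewrite /= !mul0r !scale0r.
rewrite bernsteinS IH (@eq_bernstein _ _ (fun=> c%:C *: X)) => [|m].
  by rewrite bernstein_const mulopZr -scalerDl -rmorphD -natr1 mulrDl mul1r.
by rewrite -scalerBl -rmorphB -natr1 mulrDl mul1r addrAC subrr add0r.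
Qed.

Lemma bernstein_moment2 N c X :
  bernstein N (fun m => (m%:R ^+ 2 * c)%:C *: X) =
  ((N%:R ^+ 2 - N%:R) * c)%:C *: (B * (B * X)) + (N%:R * c)%:C *: (B * X).
Proof.
elim: N => [|N IH]; first by rewrite /= expr0n subrr !mul0r !scale0r addr0.
rewrite bernsteinS IH.
rewrite (@eq_bernstein _ _ (fun m => (m%:R * (2 * c))%:C *: X + c%:C *: X)).
  rewrite bernsteinD bernstein_const bernstein_moment1 mulrDr !mulopZr.
  rewrite addrACA -!scalerDl -!rmorphD -natr1.
  by congr (_%:C *: _ + _%:C *: _); ring.
move=> m; rewrite -scalerBl -scalerDl -rmorphB -rmorphD -natr1.
by congr (_%:C *: _); ring.
Qed.

Lemma bernstein_comm N f A : GRing.comm A B ->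
  (forall m, GRing.comm A (f m)) -> GRing.comm A (bernstein N f).
Proof.
move=> cAB; elim: N f => //= N IH f cAf.
apply: commrD; apply: commrM => //; try exact: IH.
by apply: commrB => //; exact: commr1.
Qed.

Hypothesis sB : B^s = B.

Lemma bernstein_star N f : (forall m, GRing.comm B (f m)) ->
  (forall m, (f m)^s = f m) -> (bernstein N f)^s = bernstein N f.
Proof.
elim: N f => //= N IH f cBf sf.
rewrite starD !starM !IH // starD star1 starN sB.
have cB g : (forall m, GRing.comm B (g m)) -> GRing.comm B (bernstein N g).
  exact: bernstein_comm.
congr (_ + _); last by rewrite cB.
by apply: commrB; [exact: commr1|apply/commr_sym/cB].
Qed.

Hypotheses (B0 : opnneg B) (B1 : opnneg (1 - B)).

(** Each weight is a product of commuting nonnegative operators, absorbed one factor at a time by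
    [opnneg_mul]. Nonnegativity is asked only for m <= N, where the sample nodes lie in the interval
    considered. *)
Lemma bernstein_nneg N f : (forall m, GRing.comm B (f m)) ->
  (forall m, (m <= N)%N -> opnneg (f m)) -> opnneg (bernstein N f).
Proof.
elim: N f => [|N IH] f cBf f0 /=; first exact: f0.
have cB g : (forall m, GRing.comm B (g m)) -> GRing.comm B (bernstein N g).
  exact: bernstein_comm.
have c1B A : GRing.comm B A -> GRing.comm A (1 - B).
  by move=> h; apply: commrB; [exact: commr1|exact: commr_sym].
apply: opnnegD.
  rewrite -c1B; last exact: cB.
  apply: opnneg_mul; first by apply: IH => // m mN; exact/f0/leqW.
    exact/c1B/cB.
  split=> //; first by rewrite starD star1 starN sB.
  by rewrite subKr.
rewrite cB //; apply: opnneg_mul => //.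
  by apply: IH => // m mN; exact: f0.
exact/commr_sym/cB.
Qed.

End Bernstein.

(** * Approximation by polynomials in P from scalar inequalities *)

Section BernsteinApproximation.
Set Implicit Arguments.
Unset Strict Implicit.
Variables (R : realType) (V : lmodType R[i]) (ip : V -> V -> R[i]).
Variable hip : inner_product ip.
Local Notation Op := (adjop hip).
Local Notation nrm := (hnorm ip).
Local Notation q := (@opform R V ip hip).
Local Notation "A '^s'" := (op_star A) (at level 2, format "A '^s'").

Let upper_arith (n l mu e t w p1 Q xi : R) : 0 <= n -> 0 <= e -> 0 <= l ->
  l <= mu -> 0 <= Q -> 2 * e * p1 <= Q -> n * t * (xi - l * w) <= l * p1 ->
  0 <= (n + 1) * mu * Q + 2 * e * n * (t * l * w - t * xi).
Proof.
move=> n0 e0 l0 lm Q0 h1 h2.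
have h3 := ler_wpM2l (mulr_ge0 (ler0n R 2) e0) h2.
have h4 := ler_wpM2l l0 h1.
have h5 := ler_wpM2r Q0 lm.
have h6 : 0 <= n * (mu * Q) by rewrite !mulr_ge0 // (le_trans l0).
lra.
Qed.

Let lower_arith (n l mu e t w p1 p Q pxi : R) : 0 <= n -> 0 <= e -> 0 <= l ->
  l <= mu -> 0 <= Q -> - (2 * e * p1) <= Q -> p = p1 + t * w ->
  l * p1 <= n * (pxi - l * p) ->
  0 <= (n + 1) * mu * Q + 2 * e * n * (pxi - t * l * w).
Proof.
move=> n0 e0 l0 lm Q0 h1 -> h2.
have h3 := ler_wpM2l (mulr_ge0 (ler0n R 2) e0) h2.
have h4 := ler_wpM2l (mulr_ge0 (addr_ge0 n0 ler01) l0) h1.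
have h5 := ler_wpM2l (addr_ge0 n0 ler01) (ler_wpM2r Q0 lm).
lra.
Qed.

(** Since [mu] is at least 1, t <= mu <= mu^n, and the intermediate value theorem applies on
    [0, mu]. *)
Lemma exists_root_itv n (t mu : R) : (0 < n)%N -> 1 <= mu -> 0 <= t -> t <= mu ->
  exists l, [/\ 0 <= l, l <= mu & l ^+ n = t].
Proof.
move=> n0 mu1 t0 tm; have mu0 : 0 <= mu := le_trans ler01 mu1.
pose p : {poly R} := 'X^n - t%:P.
have pE u : p.[u] = u ^+ n - t by rewrite !hornerE.
have [|l /andP[l0 lm]] := @poly_ivt R p 0 mu mu0.
  rewrite !pE expr0n -[n == 0%N]negbK -lt0n n0 /= sub0r oppr_le0 t0 subr_ge0.
  rewrite (le_trans tm) // -{1}[mu]expr1.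
  by rewrite ler_weXn2l.
by rewrite rootE pE subr_eq0 => /eqP; exists l.
Qed.

(** Where P takes the value p = l^n, the two inequalities reduce to p X = p l W; so P X should be
    g(P) W with g(p) = p p^(1/n), and A is the Bernstein polynomial of g. Away from the node the
    deviation is absorbed by (P - l^n)^2 W, whose Bernstein average is a variance of order 1/N. *)
Lemma bernstein_approx n (P W X : Op) (mu om : R) :
  (0 < n)%N -> 1 <= mu -> 0 < om ->
  P^s = P -> opnneg P -> opnneg (mu%:C *: (1 : Op) - P) ->
  opnneg W -> GRing.comm P W -> GRing.comm P X ->
  (forall x, q W x <= om * nrm x ^+ 2) ->
  (forall l x, 0 <= l ->
    n%:R * l ^+ n * (q X x - l * q W x) <= l * (q (P * W) x - l ^+ n * q W x)) ->
  (forall l x, 0 <= l ->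
    l * (q (P * W) x - l ^+ n * q W x) <= n%:R * (q (P * X) x - l * q (P * W) x)) ->
  forall d, 0 < d -> exists A : Op,
    [/\ A^s = A, forall Y, GRing.comm Y P -> GRing.comm Y A &
        forall x, `|q (P * X - A * W) x| <= d * nrm x ^+ 2].
Proof.
move=> n0 mu1 om0 sP P0 muP W0 cW cX hW HU HL d d0.
have mu0 : 0 < mu := lt_le_trans ltr01 mu1.
pose B : Op := (mu^-1)%:C *: P.
have PE : P = mu%:C *: B.
  by rewrite /B scalerA -rmorphM /= divff ?lt0r_neq0 // scale1r.
have sB : B^s = B by rewrite /B starZ sP conjc_real.
have B0 : opnneg B by move=> x; rewrite opformZ mulr_ge0 ?invr_ge0 ?(ltW mu0).
have B1 : opnneg (1 - B).
  move=> x; have := muP x; rewrite !opformB !opformZ => h.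
  by rewrite subr_ge0 mulrC ler_pdivrMr // mulrC -subr_ge0.
have u1B : unit_interval_op (1 - B).
  by split; rewrite ?subKr // starD star1 starN sB.
have cBP : GRing.comm P B by exact: commZ.
have cBW : GRing.comm B W by apply/commr_sym/commZ/commr_sym.
have cBX : GRing.comm B X by apply/commr_sym/commZ/commr_sym.
have cBZ Y : GRing.comm P Y -> GRing.comm B Y.
  by move=> h; apply/commr_sym/commZ/commr_sym.
have cYB Y : GRing.comm Y P -> GRing.comm Y B by exact: commZ.
clearbody B.
(* The final error is (n+1)/n times mu e om, at most 2 mu om e = d. *)
pose e := d / (2 * mu * om).
have e0 : 0 < e by rewrite divr_gt0 // !mulr_gt0.
have dE : d = 2 * mu * om * e by rewrite /e; field; rewrite !lt0r_neq0.
pose N := (Num.bound (mu ^+ 2 / e ^+ 2)).+1.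
have N0 : 0 < N%:R :> R by rewrite ltr0n.
have hN : mu ^+ 2 / N%:R <= e ^+ 2.
  rewrite ler_pdivrMr // mulrC -ler_pdivrMr ?exprn_gt0 //.
  rewrite (le_trans (ltW (archi_boundP _))) ?ler_nat //.
  by rewrite divr_ge0 ?sqr_ge0.
pose c := mu / N%:R.
have Nc : N%:R * c = mu by rewrite /c mulrC divfK // lt0r_neq0.
have c0 : 0 < c by rewrite divr_gt0.
(* The nodes m c divide [0, mu] evenly, and [lam m] is the n-th root of the m-th node; the value 0
   beyond N is a dummy. *)
have /choice [lam lamP] : forall m, exists l, (m <= N)%N ->
    [/\ 0 <= l, l <= mu & l ^+ n = m%:R * c].
  move=> m; have [mN|_] := leqP m N; last by exists 0.
  have [||l hl] := @exists_root_itv n (m%:R * c) mu n0 mu1; last by exists l.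
    by rewrite mulr_ge0 ?ler0n ?ltW.
  by rewrite -Nc ler_pM2r // ler_nat.
pose g m := m%:R * c * lam m.
pose A := bernstein B N (fun m => (g m)%:C *: (1 : Op)).
exists A.
have AWE : A * W = bernstein B N (fun m => (g m)%:C *: W).
  rewrite /A -bernstein_mulr; apply: eq_bernstein => m.
  by rewrite mulopZl mul1r.
split.
- apply: bernstein_star => // m; first exact/commZ/commr1.
  by rewrite starZ star1 conjc_real.
- move=> Y cY; apply: bernstein_comm => [|m]; first exact: cYB.
  exact/commZ/commr1.
move=> x.
(* [f2 m] is (P - m c)^2 W. The averages of [F] and [G] being nonnegative give the upper and the
   lower estimate of P X - A W. *)
pose f2 m := P * (P * W) - (m%:R * (2 * c))%:C *: (P * W) +
             (m%:R ^+ 2 * c ^+ 2)%:C *: W.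
pose K := (n%:R + 1) * mu; pose s := 2 * e * n%:R.
pose F m := K%:C *: ((e ^+ 2)%:C *: W + f2 m) +
            s%:C *: ((g m)%:C *: W - (m%:R * c)%:C *: X).
pose G m := K%:C *: ((e ^+ 2)%:C *: W + f2 m) +
            s%:C *: (P * X - (g m)%:C *: W).
have cPP : GRing.comm P (P * W) by exact: commrM.
have cf2 m : GRing.comm B (f2 m).
  apply: commrD; last exact: commZ.
  by apply: commrB; [apply/cBZ/commrM|apply/commZ/cBZ].
have cF m : GRing.comm B (F m).
  apply: commrD; apply: commZ; first by apply: commrD => //; exact: commZ.
  by apply: commrB; exact: commZ.
have cG m : GRing.comm B (G m).
  apply: commrD; apply: commZ; first by apply: commrD => //; exact: commZ.
  by apply: commrB; [apply/cBZ/commrM|exact: commZ].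
have sq0 a y : 0 <= q (P * (P * W)) y - 2 * a * q (P * W) y + a ^+ 2 * q W y.
  have sPa : (P - a%:C *: (1 : Op))^s = P - a%:C *: (1 : Op).
    by rewrite starD starN starZ star1 conjc_real sP.
  have cWa : GRing.comm W (P - a%:C *: (1 : Op)).
    apply: commrB; first exact: commr_sym.
    exact/commZ/commr1.
  have := opnneg_sqr_mul sPa cWa W0 y.
  rewrite expr2 -mulrA (mulrBl W) mulopZl mul1r mulrBl mulopZl mul1r mulrBr.
  rewrite mulopZr scalerBr scalerA -rmorphM !(opformD, opformN, opformZ); lra.
have n0R : 0 <= n%:R :> R by exact: ler0n.
pose p1 m y := q (P * W) y - m%:R * c * q W y.
pose Q m y := q ((e ^+ 2)%:C *: W + f2 m) y.
(* Nonnegativity of (P - a)^2 W at a = m c + e and a = m c - e. *)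
have amgm m y : 2 * e * p1 m y <= Q m y /\ - (2 * e * p1 m y) <= Q m y.
  rewrite /Q /f2 !(opformD, opformN, opformZ) /p1.
  by have := sq0 (m%:R * c + e) y; have := sq0 (m%:R * c - e) y; split; lra.
have Q0 m y : 0 <= Q m y.
  by have [] := amgm m y; move: (Q m y) (2 * e * p1 m y) => u v; lra.
have F0 : opnneg (bernstein B N F).
  apply: bernstein_nneg => // m mN y; have [l0 lm lE] := lamP m mN.
  have [h1 h2] := amgm m y; have := HU (lam m) y l0; rewrite lE => h3.
  have -> : q (F m) y = K * Q m y + s * (g m * q W y - m%:R * c * q X y).
    by rewrite /F opformD opformZ [q (s%:C *: _) y]opformZ opformB !opformZ.
  by apply: upper_arith h1 h3 => //; exact: ltW.
have G0 : opnneg (bernstein B N G).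
  apply: bernstein_nneg => // m mN y; have [l0 lm lE] := lamP m mN.
  have [h1 h2] := amgm m y; have := HL (lam m) y l0; rewrite lE => h3.
  have -> : q (G m) y = K * Q m y + s * (q (P * X) y - g m * q W y).
    by rewrite /G opformD opformZ [q (s%:C *: _) y]opformZ opformB opformZ.
  by apply: lower_arith h2 _ h3 => //; [exact: ltW|rewrite subrK].
pose al := q (B * W) x; pose be := q (B * (B * W)) x.
have Ef2 : q (bernstein B N (fun m => (e ^+ 2)%:C *: W + f2 m)) x =
  e ^+ 2 * q W x + mu ^+ 2 / N%:R * (al - be).
  rewrite !bernsteinD bernsteinN !bernstein_const bernstein_moment1.
  rewrite bernstein_moment2 PE !mulopZl !mulopZr.
  rewrite !(opformD, opformN, opformZ) -/al -/be /c; field.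
  by rewrite lt0r_neq0.
have EX : bernstein B N (fun m => (m%:R * c)%:C *: X) = P * X.
  by rewrite bernstein_moment1 Nc PE mulopZl.
have EF : q (bernstein B N F) x =
  K * (e ^+ 2 * q W x + mu ^+ 2 / N%:R * (al - be)) +
  s * (q (A * W) x - q (P * X) x).
  rewrite bernsteinD !bernsteinZ opformD !opformZ Ef2.
  by rewrite bernsteinD bernsteinN EX -AWE opformB.
have EG : q (bernstein B N G) x =
  K * (e ^+ 2 * q W x + mu ^+ 2 / N%:R * (al - be)) +
  s * (q (P * X) x - q (A * W) x).
  rewrite bernsteinD !bernsteinZ opformD !opformZ Ef2.
  by rewrite bernsteinD bernsteinN bernstein_const -AWE opformB.
(* W - (B - B^2) W = W (1 - B) + B^2 W is nonnegative. *)
have albe : al - be <= q W x.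
  have h1 : opnneg (W * (1 - B)).
    apply: opnneg_mul => //; apply: commrB; [exact: commr1|exact: commr_sym].
  have h2 := opnneg_sqr_mul sB (commr_sym cBW) W0.
  have := h1 x; have := h2 x.
  rewrite expr2 -mulrA mulrBr mulr1 -cBW opformB -/al -/be; lra.
have := F0 x; have := G0 x; rewrite EF EG opformB => hG hF.
have w0 := W0 x.
have sp : 0 < s by rewrite /s mulr_gt0 ?ltr0n // mulr_gt0.
have K0 : 0 <= K by rewrite mulr_ge0 ?addr_ge0 // ltW.
have h1 : e ^+ 2 * q W x + mu ^+ 2 / N%:R * (al - be) <= 2 * e ^+ 2 * q W x.
  have muN : 0 <= mu ^+ 2 / N%:R by rewrite divr_ge0 ?sqr_ge0 ?ltW.
  have := ler_wpM2l muN albe; have := ler_wpM2r w0 hN; lra.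
have h2 : K * (2 * e ^+ 2 * q W x) <= s * (d * nrm x ^+ 2).
  have -> : s * (d * nrm x ^+ 2) = (n%:R * 2) * mu * (2 * e ^+ 2 * (om * nrm x ^+ 2)).
    by rewrite /s dE; ring.
  apply: ler_pM => //.
  - by rewrite mulr_ge0 // mulr_ge0 ?sqr_ge0.
  - rewrite /K ler_wpM2r ?(ltW mu0) // mulr_natr mulr2n lerD2l.
    by rewrite ler1n.
  - by rewrite ler_wpM2l ?hW // mulr_ge0 ?sqr_ge0.
have h3 := le_trans (ler_wpM2l K0 h1) h2.
rewrite -(ler_pM2l sp) -(ger0_norm (ltW sp)) -normrM (ger0_norm (ltW sp)).
rewrite ler_norml; apply/andP; split; lra.
Qed.

End BernsteinApproximation.
(** * The self-commutator of T *)

Section RootsOfNormal.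
Set Implicit Arguments.
Unset Strict Implicit.
Variables (R : realType) (V : lmodType R[i]) (ip : V -> V -> R[i]).
Variable hip : inner_product ip.
Local Notation Op := (adjop hip).
Local Notation nrm := (hnorm ip).
Local Notation q := (@opform R V ip hip).
Local Notation "A '^s'" := (op_star A) (at level 2, format "A '^s'").
Implicit Types (A B M T : Op) (x y : V).

(** For l > 0 the sequence a_j / l^j is convex, so its mean slope over n steps lies between the
    first slope and the one following. Clearing denominators includes l = 0. *)
Lemma weighted_convex_bounds (a : nat -> R) (l : R) n : 0 <= l ->
  (forall j, 0 <= a j.+2 - 2 * l * a j.+1 + l ^+ 2 * a j) ->
  n%:R * l ^+ n * (a 1%N - l * a 0%N) <= l * (a n - l ^+ n * a 0%N) /\
  l * (a n - l ^+ n * a 0%N) <= n%:R * (a n.+1 - l * a n).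
Proof.
move=> l0 h; pose d j := a j.+1 - l * a j.
have hd j : l * d j <= d j.+1 by have := h j; rewrite /d; lra.
have hd0 j : l ^+ j * d 0%N <= d j.
  elim: j => [|j IH]; first by rewrite expr0 mul1r.
  by rewrite exprS -mulrA (le_trans _ (hd j)) // ler_wpM2l.
rewrite -/(d 0%N) -/(d n); elim: n => [|n [IH1 IH2]].
  by rewrite expr0 !mul0r mul1r subrr mulr0.
have e : a n.+1 - l ^+ n.+1 * a 0%N = d n + l * (a n - l ^+ n * a 0%N).
  by rewrite /d exprS; ring.
rewrite e -natr1 exprS; split.
  by have := ler_wpM2l l0 (hd0 n); have := ler_wpM2l l0 IH1; lra.
have := ler_wpM2l l0 IH2; have := ler_wpM2l (ler0n R n) (hd n); have := hd n; lra.
Qed.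

Lemma hnorm_normal M x : GRing.comm M M^s -> nrm (M^s x) = nrm (M x).
Proof.
move=> cM; apply/eqP; rewrite -(@eqrXn2 _ 2) ?hnorm_ge0 //.
by rewrite -!(opform_star_mul (hip := hip)) starK cM.
Qed.

Lemma ker_star_mul M x : (M^s * M) x = 0 -> M x = 0.
Proof.
move=> h; apply: (hnorm_eq0 hip); apply/eqP; rewrite -sqrf_eq0.
by rewrite -(opform_star_mul (hip := hip)) /opform h (ip0l hip).
Qed.

(** P = M^s M is self-adjoint, so P^2 and P have the same kernel, and the exponent descends to 1. *)
Lemma ker_star_mulX M j x : ((M^s * M) ^+ j.+1) x = 0 -> M x = 0.
Proof.
elim: j => [|j IH] h; first by apply: ker_star_mul; rewrite expr1 in h.
apply: IH; set P := M^s * M in h *.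
have sP : P^s = P by rewrite starM starK.
rewrite exprS mulopE; apply: ker_star_mul.
by rewrite sP -expr2 -mulopE -exprD.
Qed.

Section QuasiParanormal.
Variables (T : Op) (n k : nat) (t : R).
Hypotheses (n0 : (0 < n)%N) (t0 : 0 <= t) (bT : opbound t T).
Hypothesis normalM : GRing.comm (T ^+ n) (T ^+ n)^s.
Hypothesis para : forall j x, (k <= j)%N ->
  nrm ((T ^+ j.+1) x) ^+ 2 <= nrm ((T ^+ j.+2) x) * nrm ((T ^+ j) x).

Let M := T ^+ n.
Let P := M^s * M.
Let Q := T^s * T.

Let cTM : GRing.comm T M. Proof. exact/commrX. Qed.

Let cTMs : GRing.comm T M^s.
Proof.
have tn : 0 <= t ^+ n by rewrite exprn_ge0.
by apply: (fuglede tn t0 normalM cTM) => //; exact: opboundX.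
Qed.

Let cTP : GRing.comm T P. Proof. exact: commrM. Qed.

Let sP : P^s = P. Proof. by rewrite starM starK. Qed.

Let sQ : Q^s = Q. Proof. by rewrite starM starK. Qed.

Let cQM : GRing.comm Q M.
Proof.
apply/commr_sym/commrM; last exact: commr_sym.
by have := comm_star cTMs; rewrite starK => h; apply: commr_sym.
Qed.

Let cQMs : GRing.comm Q M^s.
Proof. by have := comm_star cQM; rewrite sQ. Qed.

Let cQP : GRing.comm Q P. Proof. exact: commrM. Qed.

Let PX j : P ^+ j = (M ^+ j)^s * M ^+ j.
Proof. by rewrite starX exprMn_comm. Qed.

(** Together with [qQPX], this reads the forms of P^j and Q P^j off the orbit norms |T^i x|^2, at i
    = nj and i = nj + 1. *)
Let qPX j x : q (P ^+ j) x = nrm ((T ^+ (n * j)) x) ^+ 2.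
Proof. by rewrite PX opform_star_mul /M -exprM. Qed.

Let qQPX j x : q (Q * P ^+ j) x = nrm ((T ^+ (n * j).+1) x) ^+ 2.
Proof.
rewrite PX mulrA starX (commrX j cQMs) -starX -mulrA /Q -mulrA mulrA -starM.
by rewrite opform_star_mul /M -exprM -exprS.
Qed.

(** With b^2 <= c a, the expression is at least (c - l a)^2. *)
Let quadratic j l x : (k <= j)%N -> 0 <= l ->
  0 <= nrm ((T ^+ j.+2) x) ^+ 2 - 2 * l * nrm ((T ^+ j.+1) x) ^+ 2 +
       l ^+ 2 * nrm ((T ^+ j) x) ^+ 2.
Proof.
move=> kj l0; have := para x kj.
move: (nrm ((T ^+ j.+2) x)) (nrm ((T ^+ j.+1) x)) (nrm ((T ^+ j) x)) => c b a h.
have := ler_wpM2l (mulr_ge0 (ler0n R 2) l0) h.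
have := sqr_ge0 (c - l * a); lra.
Qed.

Let bounds l x : 0 <= l ->
  n%:R * l ^+ n * (q (Q * P ^+ k) x - l * q (P ^+ k) x) <=
    l * (q (P ^+ k.+1) x - l ^+ n * q (P ^+ k) x) /\
  l * (q (P ^+ k.+1) x - l ^+ n * q (P ^+ k) x) <=
    n%:R * (q (Q * P ^+ k.+1) x - l * q (P ^+ k.+1) x).
Proof.
(* Starting at nk >= k keeps every index in the range of [para], and makes a_0, a_1, a_n, a_(n+1)
   the four forms in the statement. *)
move=> l0; pose a j := nrm ((T ^+ (n * k + j)) x) ^+ 2.
have ha j : 0 <= a j.+2 - 2 * l * a j.+1 + l ^+ 2 * a j.
  rewrite /a !addnS; apply: quadratic => //.
  by rewrite (leq_trans (leq_pmull k n0)) ?leq_addr.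
have := weighted_convex_bounds n l0 ha.
by rewrite /a addn0 addn1 addnS -mulnSr -!qPX -!qQPX.
Qed.

Let mu := Num.max 1 ((t ^+ n) ^+ 2).

Let bP : forall x, q P x <= mu * nrm x ^+ 2.
Proof.
move=> x; rewrite opform_star_mul.
have bM : opbound (t ^+ n) M by exact: opboundX.
apply: (@le_trans _ _ ((t ^+ n) ^+ 2 * nrm x ^+ 2)); last first.
  by rewrite ler_wpM2r ?sqr_ge0 // /mu le_max lexx orbT.
rewrite -exprMn ler_pXn2r ?nnegrE ?mulr_ge0 ?hnorm_ge0 ?exprn_ge0 //.
Qed.

(** T commutes with P, hence with every approximant A P^k; the self-adjoint remainder D has a small
    form, so by polarization T D - D T is weakly small. *)
Let cT_QP : GRing.comm T (Q * P ^+ k.+1).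
Proof.
have mu1 : 1 <= mu by rewrite /mu le_max lexx.
have mu0 : 0 < mu := lt_le_trans ltr01 mu1.
set W := P ^+ k; set X := Q * W.
have cPW : GRing.comm P W by exact: commrX.
have cPX : GRing.comm P X by apply: commrM => //; exact: commr_sym.
have PXE : P * X = Q * P ^+ k.+1.
  by rewrite /X mulrA -cQP -mulrA /W -exprS.
pose om := mu ^+ k.
have om0 : 0 < om by rewrite exprn_gt0.
have hW x : q W x <= om * nrm x ^+ 2.
  have bM : opbound (Num.sqrt mu) M.
    move=> y; rewrite -(@ler_pXn2r _ 2) ?nnegrE ?mulr_ge0 ?hnorm_ge0 ?sqrtr_ge0 //.
    rewrite exprMn (sqr_sqrtr (ltW mu0)) -(opform_star_mul (hip := hip)).
    exact: bP.
  rewrite /W PX opform_star_mul /om -(sqr_sqrtr (ltW mu0)) [_ ^+ 2 ^+ k]exprAC -exprMn.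
  rewrite ler_pXn2r ?nnegrE ?mulr_ge0 ?hnorm_ge0 ?exprn_ge0 ?sqrtr_ge0 //.
  by apply: opboundX => //; exact: sqrtr_ge0.
have W0 : opnneg W by rewrite /W PX; exact: opnneg_star_mul.
have P0 : opnneg P by exact: opnneg_star_mul.
have muP : opnneg (mu%:C *: (1 : Op) - P).
  by move=> x; rewrite opformB opformZ opform1 subr_ge0; exact: bP.
have HU l x : 0 <= l ->
    n%:R * l ^+ n * (q X x - l * q W x) <= l * (q (P * W) x - l ^+ n * q W x).
  by move=> l0; have [] := bounds x l0; rewrite /W exprS.
have HL l x : 0 <= l ->
    l * (q (P * W) x - l ^+ n * q W x) <= n%:R * (q (P * X) x - l * q (P * W) x).
  by move=> l0; have [_] := bounds x l0; rewrite PXE /W -exprS.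
have sW : W^s = W by rewrite /W starX sP.
have sPX : (P * X)^s = P * X.
  rewrite PXE starM sQ starX sP; apply/commr_sym/commrX/cQP.
have cTW : GRing.comm T W by exact: commrX.
rewrite -PXE; apply/eqP; rewrite -subr_eq0; apply/eqP; apply: op_ext => x.
set Z := T * (P * X) - (P * X) * T.
(* Taking y = Z x and letting d tend to 0 gives Z x = 0. *)
suff small y d : 0 < d -> Re (ip (Z x) y) <=
    d * ((nrm x ^+ 2 + nrm (T^s y) ^+ 2) + (nrm (T x) ^+ 2 + nrm y ^+ 2)).
  apply: (hnorm_eq0 hip); apply/eqP; rewrite -sqrf_eq0 (hnorm2E hip).
  set r := Re _; apply/eqP/le_anti.
  have -> : 0 <= r by rewrite /r -(hnorm2E hip) sqr_ge0.
  rewrite andbT leNgt; apply/negP => r0.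
  set K := (nrm x ^+ 2 + nrm (T^s (Z x)) ^+ 2) + (nrm (T x) ^+ 2 + nrm (Z x) ^+ 2).
  have K0 : 0 <= K by rewrite !addr_ge0 ?sqr_ge0.
  have d0 : 0 < r / (K + 1) by rewrite divr_gt0 // ltr_wpDl.
  have := small (Z x) _ d0; rewrite -/K -/r mulrAC ler_pdivlMr ?ltr_wpDl //.
  by rewrite mulrDr mulr1 gerDl leNgt r0.
move=> d0.
have [A [sA cA hA]] := bernstein_approx n0 mu1 om0 sP P0 muP W0 cPW cPX hW HU HL d0.
set D := P * X - A * W in hA.
have sD : D^s = D.
  rewrite starD starN sPX starM sA sW; congr (_ - _).
  by have /commr_sym := cA W (commr_sym cPW).
have ZE : Z = T * D - D * T.
  have cTAW : GRing.comm T (A * W) by apply: commrM => //; exact: cA.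
  rewrite /D mulrBr mulrBl cTAW opprB addrA subrK.
  by [].
clearbody D.
have := opform_polarization x (T^s y) sD hA.
have := opform_polarization (T x) y sD hA.
rewrite ZE !opE (ipDl hip) (ipNl hip) Re_add Re_opp (ip_star T).
by rewrite !ler_norml => /andP[h1 h2] /andP[h3 h4]; lra.
Qed.

Lemma self_commutator_in_ker x : (T ^+ n) ((T * T^s - T^s * T) x) = 0.
Proof.
pose C := T * T^s - T^s * T.
have sC : C^s = C by rewrite starD starN !starM starK.
(* T Q P^(k+1) = Q P^(k+1) T = Q T P^(k+1), and T Q - Q T = C T. *)
have e1 : C * T * P ^+ k.+1 = 0.
  have := cT_QP; rewrite /GRing.comm -mulrA -(commrX k.+1 cTP) !mulrA.
  by move=> h; rewrite mulrBl mulrBl h /Q subrr.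
have e2 : C * M * P ^+ k.+1 = 0.
  have -> : M = T * T ^+ n.-1 by rewrite -exprS prednK.
  have cTn : GRing.comm (P ^+ k.+1) (T ^+ n.-1).
    by apply/commrX/commr_sym/commrX.
  by rewrite mulrA -mulrA -cTn mulrA e1 mul0r.
(* Taking adjoints puts C innermost, so that the kernel lemmas can strip off the powers of P and
   then M^s. *)
have e3 : P ^+ k.+1 * (M^s * C) = 0.
  have := congr1 (@op_star _ _ _ hip) e2.
  rewrite starM starM sC starX sP => ->.
  by apply: op_ext.
have e4 : M (M^s (C x)) = 0.
  apply: (@ker_star_mulX M k).
  by rewrite -[M^s (C x)]mulopE -mulopE e3.
have e5 : M^s (C x) = 0.
  by apply: ker_star_mul; rewrite starK.
apply: (hnorm_eq0 hip); rewrite -/M -/C -hnorm_normal // e5.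
exact: hnorm0.
Qed.

End QuasiParanormal.
End RootsOfNormal.
(** * Orthogonal decomposition *)

Section KernelProjection.
Set Implicit Arguments.
Unset Strict Implicit.
Variables (R : realType) (V : lmodType R[i]) (ip : V -> V -> R[i]).
Variable hip : inner_product ip.
Local Notation Op := (adjop hip).
Local Notation nrm := (hnorm ip).
Local Notation q := (@opform R V ip hip).
Local Notation "A '^s'" := (op_star A) (at level 2, format "A '^s'").
Implicit Types (A B M T : Op) (x y z : V).

Lemma nonincreasing_limit (a : nat -> R) : (forall j, a j.+1 <= a j) ->
  (forall j, 0 <= a j) -> exists L, (forall j, L <= a j) /\
  forall e, 0 < e -> exists N, forall j, (N <= j)%N -> a j < L + e.
Proof.
move=> da a0; pose E : classical_sets.set R := fun v => exists j, v = a j.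
have lE : classical_sets.has_lbound E by exists 0 => v [j ->].
have iE : classical_sets.has_inf E by split=> //; exists (a 0%N), 0%N.
exists (inf E); split=> [j|e e0]; first by apply: ge_inf => //; exists j.
have [v [N ->] aN] := inf_adherent e0 iE.
exists N => j Nj; apply: le_lt_trans aN; rewrite -(subnK Nj).
by elim: (j - N)%N => // i IH; rewrite addSn (le_trans (da _)).
Qed.

Lemma le0_epsilon (v K : R) : 0 <= K -> (forall e, 0 < e -> v <= e * K) -> v <= 0.
Proof.
move=> K0 h; rewrite leNgt; apply/negP => v0.
have e0 : 0 < v / (K + 1) by rewrite divr_gt0 // ltr_wpDl.
have := h _ e0; rewrite mulrAC ler_pdivlMr ?ltr_wpDl //.
by rewrite mulrDr mulr1 gerDl leNgt v0.
Qed.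

Lemma eq0_epsilon (v : R[i]) (K : R) : 0 <= K ->
  (forall e, 0 < e -> `|v| <= (e * K)%:C) -> v = 0.
Proof.
move=> K0 small; apply/eqP; rewrite -normr_eq0; apply/eqP.
have : 0 <= `|v| by exact: normr_ge0.
move: `|v| small => D small D0.
have DE : D = (Re D)%:C by rewrite RRe_real // ger0_real.
rewrite DE; congr (_%:C); apply/le_anti/andP; split; last by rewrite -ler0c -DE.
by apply: (@le0_epsilon _ K) => // e e0; rewrite -lecR -DE small.
Qed.

(* y is the limit of C^j x: the sequence <C^j x, x> is nonincreasing. *)
Lemma fixed_vector_projection (C : Op) x :
  (forall u, hcauchy ip u -> exists l, hconverges ip u l) ->
  unit_interval_op C ->
  exists y, C y = y /\ forall z, C z = z -> ip (x - y) z = 0.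
Proof.
move=> complete hC; have [sC C0 C1] := hC.
have Cj0 j : opnneg (C ^+ j).
  elim: j => [|j IH]; first exact: opnneg1.
  by rewrite exprSr; apply: opnneg_mul => //; apply/commr_sym/commrX.
have u1C : unit_interval_op (1 - C).
  by split; rewrite ?subKr // starD star1 starN sC.
pose a j := q (C ^+ j) x; pose u j := (C ^+ j) x.
have da j : a j.+1 <= a j.
  rewrite -subr_ge0 /a -opformB exprSr.
  rewrite -{1}[C ^+ j]mulr1 -mulrBr; apply: opnneg_mul => //.
  by apply: commrB; [exact: commr1|apply/commr_sym/commrX].
have [L [La lim]] := nonincreasing_limit da (fun j => Cj0 j x).
have uu i j : Re (ip (u i) (u j)) = a (i + j)%N.
  by rewrite /a /opform addnC exprD mulopE (ip_star (C ^+ j)) starX sC.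
(* Each term tends to the same limit L, so [u] is Cauchy. *)
have nuu i j : nrm (u i - u j) ^+ 2 = a (i + i)%N - 2 * a (i + j)%N + a (j + j)%N.
  rewrite (hnorm2E hip) (ipDl hip) !(ipDr hip) !(ipNl hip) !(ipNr hip).
  rewrite !(Re_add, Re_opp) !uu (addnC j i); lra.
have cauchy : hcauchy ip u.
  move=> e e0; have e2 : 0 < e ^+ 2 / 2 by rewrite divr_gt0 ?exprn_gt0.
  have [N hN] := lim _ e2; exists N => i j Ni Nj.
  rewrite -(@ltr_pXn2r _ 2) ?nnegrE ?hnorm_ge0 ?(ltW e0) // nuu.
  have := hN _ (leq_trans Ni (leq_addr i i)).
  have := hN _ (leq_trans Nj (leq_addr j j)).
  have := La (i + j)%N; lra.
have [y uy] := complete _ cauchy.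
(* C^2 <= C <= 1 as quadratic forms. *)
have contr v : nrm (C v) <= nrm v.
  rewrite -(@ler_pXn2r _ 2) ?nnegrE ?hnorm_ge0 //.
  rewrite -(opform_star_mul (hip := hip)) sC -(opform1 hip) -subr_ge0 -opformB.
  have [_ h _] := unit_interval_subsqr hC.
  have := h v; have := C1 v; rewrite -expr2 !opformB; lra.
exists y; split.
  apply/eqP; rewrite -subr_eq0; apply/eqP/(hnorm_eq0 hip)/le_anti.
  rewrite hnorm_ge0 andbT; apply: (@le0_epsilon _ 2) => // e e0.
  have [N hN] := uy _ e0.
  have -> : C y - y = C (y - u N) + (u N.+1 - y).
    by rewrite opB {2}/u exprS mulopE addrA subrK.
  have h1 := hN N (leqnn N); have h2 := hN _ (leqnSn N).
  rewrite (le_trans (hnormD hip _ _)) // mulr_natr mulr2n.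
  by rewrite lerD ?(ltW h2) // (le_trans (contr _)) // (hnormB hip) ltW.
move=> z Cz; have Cmz m : (C ^+ m) z = z.
  by elim: m => // m IH; rewrite exprS mulopE IH.
apply: (eq0_epsilon (hnorm_ge0 ip z)) => e e0; have [N hN] := uy _ e0.
have -> : ip (x - y) z = ip (u N - y) z.
  by rewrite !(ipDl hip) -{1}(Cmz N) (ip_starr (C ^+ N)) starX sC.
rewrite (le_trans (cauchy_schwarz hip _ _)) // lecR ler_wpM2r ?hnorm_ge0 //.
by rewrite ltW // hN.
Qed.

(** The kernel of M is the fixed space of 1 - M^s M / mu, which lies between 0 and 1 because mu =
    b^2 + 1 dominates M^s M and is positive. *)
Lemma kernel_projection M b x : 0 <= b -> opbound b M ->
  (forall u, hcauchy ip u -> exists l, hconverges ip u l) ->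
  exists y, M y = 0 /\ forall z, M z = 0 -> ip (x - y) z = 0.
Proof.
move=> b0 hM complete; pose mu := b ^+ 2 + 1.
have mu0 : 0 < mu by rewrite ltr_wpDl ?sqr_ge0.
pose B : Op := (mu^-1)%:C *: (M^s * M).
have sB : B^s = B by rewrite /B starZ starM starK conjc_real.
have qB v : q B v = mu^-1 * nrm (M v) ^+ 2 by rewrite opformZ opform_star_mul.
have hC : unit_interval_op (1 - B).
  split; first by rewrite starD star1 starN sB.
    move=> v; rewrite opformB opform1 qB subr_ge0 mulrC ler_pdivrMr //.
    rewrite (@le_trans _ _ (b ^+ 2 * nrm v ^+ 2)) //.
      by rewrite -exprMn ler_pXn2r ?nnegrE ?mulr_ge0 ?hnorm_ge0.
    by rewrite mulrC ler_wpM2l ?sqr_ge0 // lerDl.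
  by rewrite subKr => v; rewrite qB mulr_ge0 ?sqr_ge0 // invr_ge0 ltW.
have fixedE v : (1 - B) v = v <-> M v = 0.
  split=> [h|Mv]; last by rewrite !opE Mv op0 scaler0 subr0.
  have Bv : B v = 0 by rewrite -[B](subKr 1) [LHS]addopE oppopE h oneopE subrr.
  apply: (hnorm_eq0 hip); apply/eqP; rewrite -sqrf_eq0.
  have := qB v; rewrite /opform Bv (ip0l hip) => /esym/eqP.
  by rewrite mulf_eq0 invr_eq0 (negPf (lt0r_neq0 mu0)).
have [y [Cy orth]] := fixed_vector_projection x complete hC.
by exists y; split=> [|z Mz]; [apply/fixedE|apply/orth/fixedE].
Qed.

Lemma closed_kernel M b : 0 <= b -> opbound b M ->
  closed_subspace ip (fun z => M z = 0).
Proof.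
move=> b0 hM; split=> [|a x y Mx My|u l Mu ul]; first exact: op0.
  by rewrite op_lin Mx My scaler0 addr0.
apply/(hnorm_eq0 hip)/le_anti; rewrite hnorm_ge0 andbT.
apply: (@le0_epsilon _ b) => // e e0; have [N hN] := ul _ e0.
have -> : M l = M (l - u N) by rewrite opB Mu subr0.
by rewrite (le_trans (hM _)) // mulrC ler_wpM2r // (hnormB hip) ltW // hN.
Qed.

Lemma closed_orthogonal (H : V -> Prop) :
  closed_subspace ip (fun x => forall z, H z -> ip x z = 0).
Proof.
split=> [z _|a x y hx hy z Hz|u l hu ul z Hz]; first exact: ip0l.
  by rewrite (ipDl hip) (ipZl hip) hx // hy // mulr0 addr0.
apply: (eq0_epsilon (hnorm_ge0 ip z)) => e e0; have [N hN] := ul _ e0.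
have -> : ip l z = ip (l - u N) z by rewrite (ipDl hip) (ipNl hip) hu // subr0.
rewrite (le_trans (cauchy_schwarz hip _ _)) // lecR ler_wpM2r ?hnorm_ge0 //.
by rewrite (hnormB hip) ltW // hN.
Qed.

End KernelProjection.

Theorem theorem6p3 (R : realType) (V : lmodType R[i]) (ip : V -> V -> R[i])
  (T Ts : V -> V) (k n : nat) :
  hilbert_space ip ->
  bounded_linear ip T ->
  is_adjoint ip T Ts ->
  (0 < k)%N -> (0 < n)%N ->
  k_quasiparanormal ip k T ->
  (* T^n is normal: (T^n)^* (T^n) = (T^n) (T^n)^*, where (T^n)^* = (T^* )^n *)
  (forall x, opow Ts n (opow T n x) = opow T n (opow Ts n x)) ->
  exists H1 H2 : V -> Prop,
    [/\ closed_subspace ip H1 /\ closed_subspace ip H2,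
        (forall x y, H1 x -> H2 y -> ip x y = 0) /\
        (forall x, exists x1 x2, [/\ H1 x1, H2 x2 & x = x1 + x2]),
        reduces H1 T Ts /\ reduces H2 T Ts,
        (* N = T|_{H1} is normal; its adjoint is Ts|_{H1} since H1 reduces T *)
        (forall x, H1 x -> Ts (T x) = T (Ts x))
      & (* L = T|_{H2} satisfies L^{min(n, k+1)} = 0 *)
        (forall x, H2 x -> opow T (minn n k.+1) x = 0)].
Proof.
move=> [hip complete] [linT [b boundT]] adjT _ n0 quasi normalTn.
pose A : adjop hip := AdjOp hip linT adjT.
pose M := A ^+ n.
have AX j x : (A ^+ j) x = opow T j x by rewrite expopE.
have sX j x : op_star (A ^+ j) x = opow Ts j x by rewrite starX expopE.
(* The constant [b] comes without a sign. *)
pose t := Num.max 0 b.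
have t0 : 0 <= t by rewrite le_max lexx.
have bA : opbound t A.
  move=> x; rewrite (le_trans (boundT x)) // ler_wpM2r ?hnorm_ge0 //.
  by rewrite le_max lexx orbT.
have tn0 : 0 <= t ^+ n by rewrite exprn_ge0.
have bM : opbound (t ^+ n) M by exact: opboundX.
have normalM : GRing.comm M (op_star M).
  by apply: op_ext => x; rewrite !opE !sX !AX.
have para j x : (k <= j)%N -> hnorm ip ((A ^+ j.+1) x) ^+ 2 <=
    hnorm ip ((A ^+ j.+2) x) * hnorm ip ((A ^+ j) x).
  move=> kj; have := quasi (opow T (j - k) x).
  have -> : opow T k (opow T (j - k) x) = opow T j x.
    by rewrite /opow -iterD subnKC.
  by rewrite !AX.
have kerA x : M x = 0 -> M (A x) = 0.
  move=> Mx; rewrite -mulopE -exprSr exprS mulopE Mx; exact: op0.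
(* M is normal, so it has the kernel of its adjoint, which is invariant under [op_star A]. *)
have kerAs x : M x = 0 -> M (op_star A x) = 0.
  move=> Mx; apply: (hnorm_eq0 hip); rewrite -hnorm_normal // starX -mulopE.
  rewrite -exprSr exprS mulopE -starX.
  suff -> : op_star (A ^+ n) x = 0 by rewrite op0 hnorm0.
  by apply: (hnorm_eq0 hip); rewrite hnorm_normal // Mx hnorm0.
pose H1 x := forall z, M z = 0 -> ip x z = 0.
have H1A x : H1 x -> H1 (A x).
  by move=> hx z /kerAs; rewrite (ip_star A); exact: hx.
have H1As x : H1 x -> H1 (op_star A x).
  by move=> hx z /kerA Mz; rewrite -(ip_starr A) hx.
exists H1, (fun x => M x = 0); split.
- by split; [exact: closed_orthogonal|exact: closed_kernel bM].
- split=> [x y hx|x]; first exact: hx.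
  have [y [My orth]] := kernel_projection x tn0 bM complete.
  by exists (x - y), y; split=> //; rewrite subrK.
- by split; split.
- move=> x hx; set C := A * op_star A - op_star A * A.
  have MC : M (C x) = 0 by exact: (self_commutator_in_ker n0 t0 bA normalM para).
  (* H1 reduces T, so C x lies both in H1 and in the kernel of M, hence is orthogonal to itself. *)
  have hC : H1 (C x).
    move=> z Mz; rewrite /C !opE (ipDl hip) (ipNl hip).
    by rewrite (H1A _ (H1As _ hx)) // (H1As _ (H1A _ hx)) // subr0.
  have : C x = 0.
    apply: (hnorm_eq0 hip); apply/eqP; rewrite -sqrf_eq0 (hnorm2E hip).
    by rewrite hC.
  by move/eqP; rewrite /C !opE subr_eq0 => /eqP.
move=> x Mx; have [nk|kn] := leqP n k.+1; first by rewrite -AX.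
(* [para] at j = k + i bounds |T^(j+1) x|^2 by a multiple of |T^(j+2) x|, so vanishing moves down
   one power at a time; the condition j >= k stops it at k + 1. *)
have descend i : opow T (k.+1 + i) x = 0 -> opow T k.+1 x = 0.
  elim: i => [|i IH]; first by rewrite addn0.
  move=> h; apply: IH; apply: (hnorm_eq0 hip); apply/eqP; rewrite -sqrf_eq0.
  apply/eqP/le_anti; rewrite sqr_ge0 andbT -AX.
  rewrite addSn (le_trans (para _ x (leq_addr i k))) //.
  by rewrite AX -addnS -addSn h (hnorm0 hip) mul0r.
by apply: (descend (n - k.+1)%N); rewrite subnKC ?(ltnW kn) // -AX.
Qed.
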